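(* Let $p>2$ be a prime and let $\lambda$ be any ordering of $\mathbb{F}_p\times\mathbb{F}_p$. Then the Sushchansky group $G_\lambda=\langle A,B_\lambda\rangle$ has intermediate growth. Moreover its growth function satisfies $$e^{n^{\alpha}}\preceq \gamma_{G_\lambda}(n)\preceq e^{n^{\beta}},$$ where $\alpha=\frac{\log p}{\log p+\log 2}$, $\beta=\frac{\log p}{\log p-\log \eta_r}$, $r=p^2$, and $\eta_r$ is the positive root of the polynomial $x^r+x^{r-1}+x^{r-2}-2$.
   Context: Tree automorphisms. Let $p>2$ be a prime and $X=\{0,1,\dots,p-1\}$, identified with the field $\mathbb{F}_p$. The set $X^*$ of finite words over $X$ is a rooted $p$-ary tree (root the empty word; $w$ is joined to $wx$). For $g\in\mathrm{Aut}\,X^*$ and $v\in X^*$, the restriction $g|_v\in \mathrm{Aut}\,X^*$ is defined by $g(vw)=g(v)\,g|_v(w)$. Write $g=(g|_0,g|_1,\dots,g|_{p-1})\pi_g$, where $\pi_g$ is the permutation of $X$ induced by $g$ (omitted if trivial). In a product $gh$, $g$ acts first. Let $\sigma=(0,1,\dots,p-1)$ be the cyclic permutation $x\mapsto x+1$ of $X$; $\sigma$ also denotes the automorphism $(1,\dots,1)\sigma$. Sushchansky groups. Let $\lambda=\{(\alpha_i,\beta_i): i=1,\dots,p^2\}$ be an ordering (enumeration without repetition) of all pairs in $\mathbb{F}_p\times\mathbb{F}_p$. Put $u_i=0$, $v_i=1$ if $\beta_i=0$, and $u_i=1$, $v_i=-\alpha_i/\beta_i$ if $\beta_i\neq 0$.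 Define automorphisms $q_i,r_i$ ($i=1,\dots,p^2$, indices taken modulo $p^2$) of $X^*$ recursively by $$q_i=(q_{i+1},\sigma^{u_i},1,\dots,1),\qquad r_i=(r_{i+1},\sigma^{v_i},1,\dots,1).$$ Let $A=(1,\sigma,\sigma^2,\dots,\sigma^{p-1})\sigma$, and let $B_\lambda$ be the automorphism acting trivially on $X^2$ with $B_\lambda|_{00}=q_1$, $B_\lambda|_{10}=r_1$, $B_\lambda|_{21}=\sigma$, and all other restrictions $B_\lambda|_{xy}$, $xy\in X^2$, trivial. The Sushchansky group of type $\lambda$ is $G_\lambda=\langle A,B_\lambda\rangle$. Growth. For a group $G$ generated by a finite set $S$, $\gamma_G(n)$ is the number of elements of $G$ expressible as a product of at most $n$ elements of $S\cup S^{-1}$. For functions $f,g$ on positive integers, $f\preceq g$ means that there is a constant $C>0$ (which may be taken to be an integer) with $f(n)\le g(Cn)$ for all $n\geq 1$; the validity of the bounds does not depend on the choice of finite generating set. A group has intermediate growth if its growth function grows faster than every polynomial and slower than every exponential function $c^n$, $c>1$. *)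

(* Defs.v *)
From HB Require Import structures.
From mathcomp Require Import all_boot all_order all_fingroup all_algebra.
From mathcomp Require Import finmap all_classical all_reals all_analysis.
Set Implicit Arguments.
Unset Strict Implicit.
Unset Printing Implicit Defensive.
Import Order.TTheory GRing.Theory Num.Theory.
Import numFieldNormedType.Exports.
Local Open Scope classical_set_scope.

Section TreeAutomorphisms.
Variable X : finType.
Implicit Types (u v w : seq X) (f : seq X -> seq X).

Definition tree_adj u v : Prop :=
  (exists x, v = rcons u x) \/ (exists x, u = rcons v x).

Definition is_tree_aut f : Prop :=
  [/\ bijective f, f [::] = [::]
    & forall u v, tree_adj (f u) (f v) <-> tree_adj u v].

Record tree_aut := TreeAut {
  tree_aut_fun :> seq X -> seq X;
  tree_autP : is_tree_aut tree_aut_fun }.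

HB.instance Definition _ := gen_eqMixin tree_aut.
HB.instance Definition _ := gen_choiceMixin tree_aut.

Lemma tree_aut_ext (g h : tree_aut) : g =1 h -> g = h.
Proof.
case: g h => [g gP] [h hP] /= /funext E.
by move: gP hP; rewrite E => gP hP; congr TreeAut; apply: Prop_irrelevance.
Qed.

Lemma tree_aut_inv_exists (g : tree_aut) :
  exists h : tree_aut, cancel g h /\ cancel h g.
Proof.
have [[h gK hK] g0 gA] := tree_autP g.
suff hP : is_tree_aut h by exists (TreeAut hP).
split; [by exists g|by rewrite -g0 gK|].
by move=> u v; rewrite -gA !hK.
Qed.

Definition tree_aut_inv (g : tree_aut) : tree_aut :=
  sval (cid (tree_aut_inv_exists g)).

Lemma tree_autK (g : tree_aut) : cancel g (tree_aut_inv g).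
Proof. by rewrite /tree_aut_inv; case: cid => h []. Qed.

Lemma tree_autVK (g : tree_aut) : cancel (tree_aut_inv g) g.
Proof. by rewrite /tree_aut_inv; case: cid => h []. Qed.

Lemma tree_aut_one_subproof : is_tree_aut id.
Proof. by split=> //; exists id. Qed.

Definition tree_aut_one : tree_aut := TreeAut tree_aut_one_subproof.

Lemma tree_aut_mul_subproof (g h : tree_aut) : is_tree_aut (h \o g).
Proof.
have [gB g0 gA] := tree_autP g; have [hB h0 hA] := tree_autP h.
split; [exact: bij_comp|by rewrite /= g0|].
by move=> u v; rewrite hA gA.
Qed.

(* In the product [g * h] the factor [g] acts first. *)
Definition tree_aut_mul (g h : tree_aut) : tree_aut :=
  TreeAut (tree_aut_mul_subproof g h).

Lemma tree_aut_mulA : associative tree_aut_mul.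
Proof. by move=> g h k; apply: tree_aut_ext. Qed.

Lemma tree_aut_mul1g : left_id tree_aut_one tree_aut_mul.
Proof. by move=> g; apply: tree_aut_ext. Qed.

Lemma tree_aut_mulg1 : right_id tree_aut_one tree_aut_mul.
Proof. by move=> g; apply: tree_aut_ext. Qed.

Lemma tree_aut_mulVg : left_inverse tree_aut_one tree_aut_inv tree_aut_mul.
Proof. by move=> g; apply: tree_aut_ext => w /=; rewrite tree_autVK. Qed.

Lemma tree_aut_mulgV : right_inverse tree_aut_one tree_aut_inv tree_aut_mul.
Proof. by move=> g; apply: tree_aut_ext => w /=; rewrite tree_autK. Qed.

HB.instance Definition _ := isGroup.Build tree_aut tree_aut_mulA
  tree_aut_mul1g tree_aut_mulg1 tree_aut_mulVg tree_aut_mulgV.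

Lemma tree_autE1 w : (1%g : tree_aut) w = w.
Proof. by []. Qed.

Lemma tree_autEM (g h : tree_aut) w : (g * h)%g w = h (g w).
Proof. by []. Qed.

Lemma is_tree_autI f f' : cancel f f' -> cancel f' f -> f [::] = [::] ->
  (forall w x, exists y, f (rcons w x) = rcons (f w) y) ->
  (forall w x, exists y, f' (rcons w x) = rcons (f' w) y) -> is_tree_aut f.
Proof.
have adj k : (forall w x, exists y, k (rcons w x) = rcons (k w) y) ->
    forall u v, tree_adj u v -> tree_adj (k u) (k v).
  by move=> kP u v [] [x ->]; [left|right]; apply: kP.
move=> fK f'K f0 fP f'P; split=> //; first by exists f'.
move=> u v; split; last exact: adj.
by move/(adj _ f'P); rewrite !fK.
Qed.

Lemma tree_aut_rcons (g : tree_aut) w x :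
  exists y, g (rcons w x) = rcons (g w) y.
Proof.
have [gB g0 gA] := tree_autP g; have gI := bij_inj gB.
elim/last_ind: w x => [|w z IHw] x.
  have [//|[y Ey]|[y]] := (gA [::] (rcons [::] x)).2; first by left; exists x.
    by exists y.
  by rewrite g0 => /(congr1 size); rewrite size_rcons.
have [|[y Ey]|[y Ey]] := (gA (rcons w z) (rcons (rcons w z) x)).2.
- by left; exists x.
- by exists y.
- have [t Et] := IHw z; move: Ey; rewrite Et => /rcons_inj [/gI /(congr1 size)].
  by rewrite !size_rcons => /eqP; rewrite -[X in X == _]addn0 -addn2 eqn_add2l.
Qed.

Definition wreath_fun (g : X -> tree_aut) (pi : {perm X}) w : seq X :=
  if w is x :: w' then pi x :: g x w' else [::].

Lemma wreath_subproof g pi : is_tree_aut (wreath_fun g pi).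
Proof.
have wr h rho w x : exists y,
    wreath_fun h rho (rcons w x) = rcons (wreath_fun h rho w) y.
  case: w => [|z w] /=; last first.
    by have [y ->] := tree_aut_rcons (h z) w x; exists y.
  have [_ h0 _] := tree_autP (h x).
  by exists (rho x); rewrite h0.
apply: (@is_tree_autI _ (wreath_fun (fun x => (g (pi^-1%g x))^-1%g) pi^-1%g)) => //.
- by case=> [|x w] //=; rewrite !permK tree_autK.
- by case=> [|x w] //=; rewrite !permKV tree_autVK.
Qed.

(* [wreath g pi] is the automorphism usually written (g_0, ..., g_(p-1)) pi:
   it acts by [pi] on the first letter, and its restriction (section) at the
   one-letter word [x] is [g x]. *)
Definition wreath (g : X -> tree_aut) (pi : {perm X}) : tree_aut :=
  TreeAut (wreath_subproof g pi).

Fixpoint spinal_fun (I : Type) (a b : X) (nxt : I -> I) (s : I -> tree_aut)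
    (i : I) w : seq X :=
  if w is x :: w' then
    x :: (if x == a then spinal_fun a b nxt s (nxt i) w'
          else if x == b then s i w' else w')
  else [::].

Lemma spinal_subproof I a b nxt s i : is_tree_aut (@spinal_fun I a b nxt s i).
Proof.
have sp t j w x : exists y, spinal_fun a b nxt t j (rcons w x) =
    rcons (spinal_fun a b nxt t j w) y.
  elim: w j => [|z w IHw] j /=.
    exists x; case: eqP => // _; case: eqP => // _.
    by have [_ -> _] := tree_autP (t j).
  case: eqP => _; first by have [y ->] := IHw (nxt j); exists y.
  case: eqP => _; last by exists x.
  by have [y ->] := tree_aut_rcons (t j) w x; exists y.
apply: (@is_tree_autI _ (spinal_fun a b nxt (fun i => (s i)^-1%g) i)) => //.
- move=> w; elim: w i => [|x w IHw] j //=; congr cons.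
  by case: eqP => _; [exact: IHw|case: eqP => _ //; exact: tree_autK].
- move=> w; elim: w i => [|x w IHw] j //=; congr cons.
  by case: eqP => _; [exact: IHw|case: eqP => _ //; exact: tree_autVK].
Qed.

(* The family of automorphisms defined by the wreath recursion [spinalE]:
   [spinal a b nxt s i] has restriction [spinal a b nxt s (nxt i)] at [a],
   restriction [s i] at [b], and trivial restriction at all other letters. *)
Definition spinal (I : Type) (a b : X) (nxt : I -> I) (s : I -> tree_aut)
    (i : I) : tree_aut :=
  TreeAut (@spinal_subproof I a b nxt s i).

Lemma spinalE I a b (nxt : I -> I) s i :
  spinal a b nxt s i = wreath (fun x => if x == a then spinal a b nxt s (nxt i)
                                        else if x == b then s i else 1%g) 1%g.
Proof.
apply: tree_aut_ext => -[|x w] //=; rewrite perm1.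
by case: eqP => // _; case: eqP.
Qed.

End TreeAutomorphisms.

Section Growth.
Variable T : groupType.
Implicit Types (S : set T) (n : nat).

Definition gen_subgroup S : set T :=
  smallest [set H : set T | group_closed [in H]] S.

Definition growth_ball S n : set T :=
  [set g | exists s : seq T,
    [/\ (size s <= n)%N, {in s, forall x, S x \/ S (x^-1)%g}
      & g = (\prod_(x <- s) x)%g]].

Lemma finite_growth_ball S n : finite_set S -> finite_set (growth_ball S n).
Proof.
move=> Sfin; elim: n => [|n IHn].
  apply: (@sub_finite_set _ _ [set 1%g]); last exact: finite_set1.
  by move=> g [s [] ]; rewrite leqn0 => /nilP -> _ ->; rewrite big_nil.
pose U := S `|` [set x^-1%g | x in S].
have Ufin : finite_set U by rewrite finite_setU; split=> //; exact: finite_image.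
pose M := [set (p.1 * p.2)%g | p in U `*` growth_ball S n].
have Mfin : finite_set M by apply/finite_image/finite_setX.
apply: (@sub_finite_set _ _ ([set 1%g] `|` M)); last first.
  by rewrite finite_setU; split=> //; exact: finite_set1.
move=> g [[|x s] [ssz sS ->]]; first by left; rewrite big_nil.
right; exists (x, (\prod_(y <- s) y)%g) => /=; last by rewrite big_cons.
split=> /=; last by exists s; split=> // y ys; apply: sS; rewrite in_cons ys orbT.
have [Sx|SVx] := sS x (mem_head _ _); [by left|right].
by exists (x^-1)%g; rewrite ?invgK.
Qed.

(* [fset_set] is the underlying finite set by [finite_growth_ball]. *)
Definition growth S n : nat := #|` fset_set (growth_ball S n)|%fset.

End Growth.

Local Open Scope ring_scope.

Section GrowthComparison.
Variable R : realType.
Implicit Types f g gamma : nat -> R.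

Definition growth_le f g : Prop :=
  exists C : nat, (0 < C)%N /\ forall n, (0 < n)%N -> f n <= g (C * n)%N.

Definition intermediate_growth gamma : Prop :=
  (forall P : {poly R}, P.[n%:R] / gamma n @[n --> \oo] --> (0 : R)) /\
  (forall c : R, 1 < c -> gamma n / c ^+ n @[n --> \oo] --> (0 : R)).

Definition eta_poly (r : nat) : {poly R} :=
  'X^r + 'X^(r - 1) + 'X^(r - 2) - 2%:P.

End GrowthComparison.

Section Sushchansky.
Variable p : nat.

Definition cycle_perm : {perm 'F_p} := perm (addIr (1 : 'F_p)).

Definition sigma : tree_aut 'F_p := wreath (fun=> 1%g) cycle_perm.

(* An ordering of all pairs is a bijection [lam]; using the ring 'Z_(p ^ 2) as
   index set, [i + 1] is the next index modulo [p ^ 2], and the index [p ^ 2]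
   is represented by [0]. *)
Variable lam : 'Z_(p ^ 2) -> 'F_p * 'F_p.

Definition sush_u (i : 'Z_(p ^ 2)) : 'F_p :=
  if (lam i).2 == 0 then 0 else 1.

Definition sush_v (i : 'Z_(p ^ 2)) : 'F_p :=
  if (lam i).2 == 0 then 1 else - ((lam i).1 / (lam i).2).

Definition sush_q : 'Z_(p ^ 2) -> tree_aut 'F_p :=
  spinal 0 1 (fun i => i + 1) (fun i => (sigma ^+ sush_u i)%g).

Definition sush_r : 'Z_(p ^ 2) -> tree_aut 'F_p :=
  spinal 0 1 (fun i => i + 1) (fun i => (sigma ^+ sush_v i)%g).

Definition sush_A : tree_aut 'F_p := 
  wreath (fun x : 'F_p => (sigma ^+ x)%g) cycle_perm.

Definition sush_B : tree_aut 'F_p :=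
  wreath (fun x => wreath (fun y =>
    if (x, y) == (0, 0) then sush_q 1
    else if (x, y) == (1, 0) then sush_r 1
    else if (x, y) == (2%:R, 1) then sigma
    else 1%g) 1%g) 1%g.

Definition sushchansky_group : set (tree_aut 'F_p) :=
  gen_subgroup [set sush_A; sush_B].

End Sushchansky.

(* Main.v *)
Require Import Defs.
From HB Require Import structures.
From mathcomp Require Import all_boot all_order all_fingroup all_algebra.
From mathcomp Require Import finmap all_classical all_reals all_analysis.
From mathcomp Require Import ring lra.
Set Implicit Arguments.
Unset Strict Implicit.
Unset Printing Implicit Defensive.
Import Order.TTheory GRing.Theory Num.Theory.
Import numFieldNormedType.Exports.
Local Open Scope classical_set_scope.
Local Open Scope ring_scope.

(* The sections of G at words of length 2 lie in the group K_1 generated by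
   sigma and by the elements beta_1 c = q_1^c.1 r_1^c.2 with c in F_p^2, and
   conversely a bounded conjugation lifts words of K_1 to G, so it suffices to
   estimate the groups K_i generated by sigma and the
   beta_i c = (beta_{i+1} c, sigma^(phi_i c), 1, ..., 1), where phi_i is the
   linear form c.1 u_i + c.2 v_i, which kills lambda_i.

   Lower bound: a product of k factors sigma^j beta_{i+1} c lifts to a product
   of 2k such factors in K_i that fixes the first level, has the given section
   at 0 and sections in finite sets elsewhere.  Multiplying p conjugates of
   such lifts gives N_i(2pk) >= N_{i+1}(k)^p / const, whence exp(n^alpha) with
   (2p)^alpha = p.

   Upper bound: every c is killed by some phi_i among any r = p^2 consecutive
   ones.  Weighting beta_i c according to the waiting time until it is killed,
   the weights of the first-level sections of an element of weight n add up to
   at most eta (n + const).  Hence the portrait of an element, cut at bounded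
   weight, has O(n^beta) vertices with p (eta/p)^beta = 1, and it determines
   the element. *)

(** * Word balls and growth functions *)

Section Balls.
Variable T : groupType.
Implicit Types (S : set T) (n m : nat).

Lemma growth_ball1 S n : growth_ball S n 1%g.
Proof. by exists [::]; split=> //; rewrite big_nil. Qed.

Lemma growth_ballM S n m g h :
  growth_ball S n g -> growth_ball S m h -> growth_ball S (n + m) (g * h)%g.
Proof.
move=> [s [sz sS ->]] [t [tz tS ->]]; exists (s ++ t); split.
- by rewrite size_cat leq_add.
- by move=> x; rewrite mem_cat => /orP [/sS|/tS].
- by rewrite big_cat.
Qed.

Lemma growth_ballV S n g : growth_ball S n g -> growth_ball S n (g^-1)%g.
Proof.
move=> [s [sz sS ->]]; exists (rev (map (@invg T) s)); split.
- by rewrite size_rev size_map.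
- move=> x; rewrite mem_rev => /mapP [y ys ->].
  by rewrite invgK; case: (sS y ys); [right|left].
- by rewrite -map_rev big_map prodgV revK.
Qed.

Lemma growth_ball_le S n m : (n <= m)%N -> growth_ball S n `<=` growth_ball S m.
Proof. by move=> nm g [s [sz sS ->]]; exists s; split=> //; apply: leq_trans nm. Qed.

Lemma growth_ballX S n k g :
  growth_ball S n g -> growth_ball S (k * n) (g ^+ k)%g.
Proof.
move=> gS; elim: k => [|k IHk]; first exact: growth_ball1.
by rewrite expgS mulSn; apply: growth_ballM.
Qed.

Lemma growth_ball_gen S g : S g -> growth_ball S 1 g.
Proof.
move=> Sg; exists [:: g]; split=> //; last by rewrite big_seq1.
by move=> x; rewrite inE => /eqP ->; left.
Qed.

Lemma growth_ball_prod S L n (s : seq T) :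
  (size s <= n)%N -> {in s, forall x, growth_ball S L x} ->
  growth_ball S (L * n) (\prod_(x <- s) x)%g.
Proof.
move=> sz sL; apply: (@growth_ball_le _ (L * size s)); first by rewrite leq_mul2l sz orbT.
elim: s sL {sz} => [|x s IHs] sL; first by rewrite big_nil; exact: growth_ball1.
rewrite big_cons mulnS; apply: growth_ballM; first by apply: sL; rewrite mem_head.
by apply: IHs => y ys; apply: sL; rewrite in_cons ys orbT.
Qed.

Lemma gen_subgroup_ball S g : gen_subgroup S g <-> exists n, growth_ball S n g.
Proof.
split=> [|[n [s [_ sS ->]]] H [Hgrp SH]].
  apply: (@smallest_sub _ _ S [set g | exists n, growth_ball S n g]).
    split; first by rewrite inE; exists 0%N; exact: growth_ball1.
    move=> x y; rewrite !inE /= => -[n xn] [m ym].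
    by exists (n + m)%N; apply/growth_ballM/growth_ballV.
  by move=> x Sx; exists 1%N; exact: growth_ball_gen.
elim: s sS => [|x s IHs] sS; first by rewrite big_nil; have [] := Hgrp; rewrite inE.
rewrite big_cons; apply/set_mem/(group_closedM Hgrp); last first.
  by apply/mem_set/IHs => y ys; apply: sS; rewrite in_cons ys orbT.
case: (sS x (mem_head _ _)) => [/SH /mem_set //|/SH /mem_set /(group_closedV Hgrp)].
by rewrite invgK.
Qed.

(** Each of the finitely many generators in [S] has some length over [S']; a common bound [L]
    rescales the radius. This makes the growth estimates independent of the generating set. *)
Lemma growth_ball_sub S S' : finite_set S -> S `<=` gen_subgroup S' ->
  exists2 L, (0 < L)%N & forall n, growth_ball S n `<=` growth_ball S' (L * n).
Proof.
move=> Sfin SS'.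
have [L SL] : exists L, forall x, S x -> growth_ball S' L x.
  pose F x := xget 0%N [set n | growth_ball S' n x].
  exists (\max_(x <- fset_set S) F x)%N => x Sx.
  have xF : growth_ball S' (F x) x.
    apply: (@xgetPex _ 0%N [set n | growth_ball S' n x]).
    exact: (gen_subgroup_ball S' x).1 (SS' x Sx).
  apply: growth_ball_le xF; apply: leq_bigmax_seq => //.
  by rewrite in_fset_set // inE.
(* The successor keeps the constant positive when the bound [L] is 0. *)
exists L.+1 => // n g [s [sz sS ->]]; apply: growth_ball_prod => // x xs.
apply: (@growth_ball_le _ L) => //.
by case: (sS x xs) => /SL // /growth_ballV; rewrite invgK.
Qed.

Lemma leq_growth S S' n m : finite_set S' ->
  growth_ball S n `<=` growth_ball S' m -> (growth S n <= growth S' m)%N.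
Proof.
move=> S'fin sub; apply/fsubset_leq_card/fsubsetP => g.
have F' : finite_set (growth_ball S' m) by exact: finite_growth_ball.
rewrite !in_fset_set // ?inE; [exact: sub|exact: sub_finite_set F'].
Qed.

Lemma growth_homo S : finite_set S -> {homo growth S : n m / (n <= m)%N}.
Proof. by move=> Sfin n m nm; apply/leq_growth/growth_ball_le. Qed.

Lemma size_leq_growth S n (s : seq T) : finite_set S -> uniq s ->
  {in s, forall g, growth_ball S n g} -> (size s <= growth S n)%N.
Proof.
move=> Sfin us sS; have F := finite_growth_ball n Sfin.
rewrite -(undup_id us) -card_fseq; apply/fsubset_leq_card/fsubsetP => g.
by rewrite in_fset_set // !inE => /sS.
Qed.

Lemma growth_leq_card S n (I : finType) (f : I -> T) : finite_set S ->
  (forall g, growth_ball S n g -> exists i, g = f i) -> (growth S n <= #|I|)%N.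
Proof.
move=> Sfin fP; have F := finite_growth_ball n Sfin.
apply: (@leq_trans (size (undup (codom f)))); last first.
  by rewrite -(size_codom f) size_undup.
rewrite -card_fseq; apply/fsubset_leq_card/fsubsetP => g.
by rewrite in_fset_set // !inE => /fP [i ->]; apply: codom_f.
Qed.
End Balls.

(** * Wreath recursion for the groups generated by sigma and the q_i, r_i *)

Section Wreath.
Variable X : finType.
Implicit Types (g h : X -> tree_aut X) (pi rho : {perm X}).

Lemma wreathM g pi h rho :
  (wreath g pi * wreath h rho)%g =
  wreath (fun x => g x * h (pi x))%g (pi * rho)%g.
Proof. by apply: tree_aut_ext => -[|x w] //=; rewrite permM. Qed.

Lemma wreath1 : wreath (fun=> 1%g) 1%g = 1%g :> tree_aut X.
Proof. by apply: tree_aut_ext => -[|x w] //=; rewrite perm1. Qed.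

Lemma eq_wreath g h pi : g =1 h -> wreath g pi = wreath h pi.
Proof. by move=> /funext ->. Qed.

Lemma wreathV g pi :
  ((wreath g pi)^-1 = wreath (fun x => (g (pi^-1 x))^-1) pi^-1)%g.
Proof.
apply: (@mulgI _ (wreath g pi)); rewrite mulgV wreathM mulgV -[LHS]wreath1.
by apply: eq_wreath => x; rewrite permK mulgV.
Qed.

Lemma wreath_inj g pi h rho : wreath g pi = wreath h rho -> g =1 h /\ pi = rho.
Proof.
move=> E; have {}E w : wreath g pi w = wreath h rho w by rewrite E.
split=> [x|]; last by apply/permP => x; have [] := E [:: x].
by apply: tree_aut_ext => w; have [_] := E (x :: w).
Qed.

End Wreath.

Section Letters.
Variable p : nat.

Definition shift (x : 'F_p) : {perm 'F_p} := perm (addIr x).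

Definition sg (x : 'F_p) : tree_aut 'F_p := (sigma p ^+ x)%g.
(* In [%g], [1 : 'F_p] would denote the neutral element 0 of the additive group. *)
Arguments sg x%_R.

Lemma sgE x : sg x = wreath (fun=> 1%g) (shift x).
Proof.
rewrite /sg -[in RHS](natr_Zp x); elim: (x : nat) => [|n IHn].
  rewrite -[LHS]wreath1; congr wreath.
  by apply/permP => y; rewrite !permE addr0.
rewrite expgSr IHn wreathM; congr wreath; first by apply/funext => y; rewrite mulg1.
by apply/permP => y; rewrite permM !permE -natr1 addrA.
Qed.

Lemma shiftD x y : shift (x + y) = (shift x * shift y)%g.
Proof. by apply/permP => z; rewrite permM !permE addrA. Qed.

Lemma shift0 : shift 0 = 1%g.
Proof. by apply/permP => z; rewrite !permE addr0. Qed.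

Lemma shift_inj : injective shift.
Proof. by move=> x y /permP /(_ 0); rewrite !permE !add0r. Qed.

Lemma sgD x y : sg (x + y) = (sg x * sg y)%g.
Proof. by rewrite !sgE wreathM shiftD; apply: eq_wreath => z; rewrite mulg1. Qed.

Lemma sg0 : sg 0 = 1%g.
Proof. by rewrite sgE shift0 wreath1. Qed.

Lemma sgN x : sg (- x) = ((sg x)^-1)%g.
Proof. by apply: (@mulIg _ (sg x)); rewrite mulVg -sgD addNr sg0. Qed.

Lemma sg_wreath x g pi :
  (sg x * wreath g pi)%g = wreath (fun y => g (y + x)) (shift x * pi)%g.
Proof. by rewrite sgE wreathM; apply: eq_wreath => y; rewrite mul1g permE. Qed.

Lemma wreath_sg x g pi : (wreath g pi * sg x)%g = wreath g (pi * shift x)%g.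
Proof. by rewrite sgE wreathM; apply: eq_wreath => y; rewrite mulg1. Qed.

Variable lam : 'Z_(p ^ 2) -> 'F_p * 'F_p.
Implicit Types (i : 'Z_(p ^ 2)) (c d : 'F_p * 'F_p).

Definition phi i c : 'F_p := c.1 * sush_u lam i + c.2 * sush_v lam i.

Lemma phiD i c d : phi i (c + d) = phi i c + phi i d.
Proof. by rewrite /phi /= !mulrDl addrACA. Qed.

Lemma phi_lam i : phi i (lam i) = 0.
Proof.
rewrite /phi /sush_u /sush_v; case: eqP => [->|/eqP nz].
  by rewrite mulr0 mulr1 addr0.
by rewrite mulr1 mulrN mulrC divfK // subrr.
Qed.

(** One of the two coefficients [u_i], [v_i] is always 1, so the linear form is nonzero. *)
Lemma phi_surj i x : exists d, phi i d = x.
Proof.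
rewrite /phi /sush_u /sush_v; case: eqP => _; [exists (0, x)|exists (x, 0)] => /=.
  by rewrite mulr0 add0r mulr1.
by rewrite mulr1 mul0r addr0.
Qed.

Definition beta i c : tree_aut 'F_p :=
  spinal 0 1 (fun i => i + 1) (fun i => sg (phi i c)) i.

Lemma betaE i c : beta i c = wreath (fun x => if x == 0 then beta (i + 1) c
  else if x == 1 then sg (phi i c) else 1%g) 1%g.
Proof. exact: spinalE. Qed.

(** All these automorphisms fix the ray 000... and act by powers of sigma on the subtrees hanging
    off it, so they multiply branch by branch, and [phi] is additive. Thus [beta i] is a
    homomorphism, and [q_i] and [r_i] commute. *)
Lemma betaD i c d : beta i (c + d) = (beta i c * beta i d)%g.
Proof.
apply: tree_aut_ext => w; rewrite tree_autEM /=.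
elim: w i => [|x w IHw] i //=; congr cons.
by case: eqP => _; [exact: IHw|case: eqP => _ //; rewrite phiD sgD].
Qed.

Lemma beta0 i : beta i 0 = 1%g.
Proof. by apply: (@mulIg _ (beta i 0)); rewrite -betaD addr0 mul1g. Qed.

Lemma betaN i c : beta i (- c) = ((beta i c)^-1)%g.
Proof. by apply: (@mulIg _ (beta i c)); rewrite mulVg -betaD addNr beta0. Qed.

Lemma sush_qE i : sush_q lam i = beta i (1, 0).
Proof.
rewrite /beta /sush_q; congr spinal; apply/funext => j.
by rewrite /phi mul1r mul0r addr0.
Qed.

Lemma sush_rE i : sush_r lam i = beta i (0, 1).
Proof.
rewrite /beta /sush_r; congr spinal; apply/funext => j.
by rewrite /phi mul1r mul0r add0r.
Qed.

Lemma betaX i c n : (beta i c ^+ n)%g = beta i (c *+ n).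
Proof.
by elim: n => [|n IHn]; rewrite ?expg0 ?mulr0n ?beta0 // expgS IHn mulrS betaD.
Qed.

End Letters.

Arguments sg {p} x%_R.
Arguments shift {p} x%_R.
Arguments beta {p} lam i%_R c%_R.

(** * Lower bound *)

(** Cancelling the common factors to the left and to the right needs no commutativity. It serves to
    read one factor off a product whose other factors are known. *)
Lemma prodg_cancel (T : groupType) (I : eqType) (s : seq I) (F G : I -> T) i :
  uniq s -> i \in s -> (forall j, j \in s -> j != i -> F j = G j) ->
  (\prod_(j <- s) F j = \prod_(j <- s) G j)%g -> F i = G i.
Proof.
elim: s => [|x s IHs] //= /andP [xs us]; rewrite in_cons !big_cons.
case: eqVneq => [-> _|ix /= is_] FG.
  rewrite (_ : \prod_(j <- s) F j = \prod_(j <- s) G j)%g; first exact: mulIg.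
  apply: eq_big_seq => j js; apply: FG; first by rewrite in_cons js orbT.
  by apply: contraNneq xs => <-.
rewrite FG ?mem_head 1?eq_sym // => /mulgI; apply: IHs => // j js.
by apply: FG; rewrite in_cons js orbT.
Qed.

Section LowerBound.
Variables (p : nat) (lam : 'Z_(p ^ 2) -> 'F_p * 'F_p).
Hypotheses (p_prime : prime p) (p_gt2 : (2 < p)%N).
Implicit Types (i : 'Z_(p ^ 2)) (c d : 'F_p * 'F_p) (k : nat).

Lemma natr_Fp_eq0 n : ((n%:R : 'F_p) == 0) = (p %| n)%N.
Proof. by rewrite -(dvdn_pcharf (pchar_Fp p_prime)). Qed.

Lemma natr_Fp_inj : {in gtn p &, injective (fun n => n%:R : 'F_p)}.
Proof.
move=> m n mp np /(congr1 val) /=.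
by rewrite !val_Fp_nat // !modn_small.
Qed.

Lemma Fp_ltn (x : 'F_p) : (x < p)%N.
Proof. by rewrite -[X in (_ < X)%N](Fp_cast p_prime) ltn_ord. Qed.

Lemma two_neq0 : (2%:R : 'F_p) != 0.
Proof. by rewrite natr_Fp_eq0 gtnNdvd. Qed.

Definition pairs_prod i (s : seq ('F_p * ('F_p * 'F_p))) : tree_aut 'F_p :=
  (\prod_(a <- s) (sg a.1 * beta lam i a.2))%g.

Definition pairs_set i k : set (tree_aut 'F_p) :=
  [set g | exists2 s, size s = k & g = pairs_prod i s].

Lemma pairs_setM i k l g h :
  pairs_set i k g -> pairs_set i l h -> pairs_set i (k + l) (g * h)%g.
Proof.
move=> [s <- ->] [t <- ->]; exists (s ++ t); first by rewrite size_cat.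
by rewrite /pairs_prod big_cat.
Qed.

Lemma sg_pairs_set i k j g :
  (0 < k)%N -> pairs_set i k g -> pairs_set i k (sg j * g)%g.
Proof.
move=> k0 [[|a s] sk ->]; first by rewrite -sk in k0.
exists ((j + a.1, a.2) :: s); first exact: sk.
by rewrite /pairs_prod !big_cons /= sgD !mulgA.
Qed.

Lemma pairs_set_prod i k (s : seq nat) (F : nat -> tree_aut 'F_p) :
  (forall m, pairs_set i k (F m)) ->
  pairs_set i (k * size s) (\prod_(m <- s) F m)%g.
Proof.
move=> FP; elim: s => [|m s IHs].
  by rewrite muln0 big_nil; exists [::] => //; rewrite /pairs_prod big_nil.
by rewrite mulnS big_cons; apply: pairs_setM.
Qed.

(** The form of the lifts of [g]: besides [g], only the data [lc] remain free, and they take p^3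
    values. The letters 0, 1 and -1 are distinct because p > 2. *)
Definition lift_sections i (g : tree_aut 'F_p) (lc : 'F_p * ('F_p * 'F_p))
    (x : 'F_p) : tree_aut 'F_p :=
  if x == 0 then g else if x == 1 then sg lc.1
  else if x == -1 then beta lam (i + 1) lc.2 else 1%g.

(* Each factor [sg j * beta c] is lifted to [sg 1 * beta d * sg (-1) * beta c]
   with [phi i d = j], whose section at [0] is that factor. *)
Lemma pairs_set_lift i k g : pairs_set (i + 1) k g ->
  exists lc, pairs_set i (2 * k) (wreath (lift_sections i g lc) 1%g).
Proof.
move=> [s <- ->] {k}; elim: s => [|[j c] s [[l b] IHs]].
  exists 0; exists [::] => //; rewrite /pairs_prod !big_nil -[RHS]wreath1.
  apply: eq_wreath => x; rewrite /lift_sections sg0 beta0.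
  by do 3![case: ifP => // _].
have [d dj] := phi_surj lam i j.
exists (phi lam i c + l, d + b) => /=; rewrite mulnS.
have -> : wreath (lift_sections i (pairs_prod (i + 1) ((j, c) :: s))
      (phi lam i c + l, d + b)) 1%g =
    ((sg 1 * beta lam i d) * (sg (-1) * beta lam i c) *
      wreath (lift_sections i (pairs_prod (i + 1) s) (l, b)) 1)%g.
  rewrite (betaE lam i d) (betaE lam i c). rewrite (sg_wreath 1) (sg_wreath (-1)) !mulg1.
  rewrite !wreathM mulg1 -shiftD subrr shift0; apply: eq_wreath => x.
  rewrite perm1 permE addrK /lift_sections /pairs_prod big_cons /= dj.
  have n10 : (1 : 'F_p) == 0 = false by apply/negbTE/oner_neq0.
  have n2 : (1 + 1 : 'F_p) == 0 = false by apply/negbTE; exact: two_neq0.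
  have nm1 : (-1 : 'F_p) == 1 = false by rewrite eq_sym -addr_eq0 n2.
  have nm0 : (-1 : 'F_p) == 0 = false by rewrite oppr_eq0 n10.
  have [->|x0] := eqVneq x 0; first by rewrite add0r n10 eqxx ?mulgA.
  have [->|x1] := eqVneq x 1.
    by rewrite n2 -subr_eq0 addrK n10 mul1g sgD.
  have [->|xm] := eqVneq x (-1).
    by rewrite addNr eqxx mulg1 betaD.
  rewrite addr_eq0 (negbTE xm) -subr_eq0 addrK (negbTE x0).
  by rewrite !mulg1.
apply: (@pairs_setM i 2) => //; exists [:: (1, d); (-1, c)] => //.
by rewrite /pairs_prod !big_cons big_nil mulg1.
Qed.

(** The rotations by -1 accumulate, so the letter [y] has moved to [y - (m + 1)] when factor number
    [m] acts on it. For [M = p] each letter thus visits 0 exactly once. *)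
Lemma shifted_prod M (F : nat -> 'F_p -> tree_aut 'F_p) :
  (\prod_(0 <= m < M) (sg (-1) * wreath (F m) 1) =
   wreath (fun y => \prod_(0 <= m < M) F m (y - m.+1%:R)) (shift (- M%:R)))%g.
Proof.
elim: M => [|M IHM].
  rewrite big_nil oppr0 shift0 -[LHS]wreath1; apply: eq_wreath => y.
  by rewrite big_nil.
rewrite big_nat_recr //= IHM mulgA wreath_sg wreathM mulg1 -shiftD.
rewrite -opprD natr1; apply: eq_wreath => y.
by rewrite big_nat_recr //= permE.
Qed.

(** A duplicate-free list witnesses the cardinality without any finiteness assumption on [A]. *)
Definition large (T : eqType) (A : set T) (N : nat) : Prop :=
  exists s : seq T, [/\ uniq s, {in s, forall g, A g} & (N <= size s)%N].

(** The function [g] separates the points of each fibre of [f], so a fibre has at most [#|J|]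
    points. *)
Lemma card_codom_injective (T : eqType) (I J : finType) (f : I -> T) (g : I -> J) :
  injective (fun x => (f x, g x)) ->
  (#|I| <= size (undup (codom f)) * #|J|)%N.
Proof.
move=> fg; pose s := undup (codom f).
have fs x : f x \in s by rewrite mem_undup codom_f.
have h_inj : injective (fun x => (Ordinal (eq_ind_r is_true (fs x) (index_mem (f x) s)), g x)).
  move=> x y [/(congr1 (nth (f x) s))]; rewrite !nth_index // => fxy gxy.
  by apply: fg; rewrite fxy gxy.
by have := leq_card _ h_inj; rewrite card_prod card_ord.
Qed.

(* A tuple [f] of elements is recovered from the product [X f] of its lifts once
   the [p ^ 3] possible values of each pair of side sections are known. *)
Lemma pairs_set_power i k N M : (0 < k)%N -> large (pairs_set (i + 1) k) N ->
  (M * (p ^ 3) ^ p <= N ^ p)%N -> large (pairs_set i (2 * k * p)) M.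
Proof.
move=> k0 [s [us sP Ns]] MN.
have lift g : exists lc, g \in s -> pairs_set i (2 * k) (wreath (lift_sections i g lc) 1%g).
  have [gs|gs] := boolP (g \in s); last by exists 0.
  by have [lc lcP] := pairs_set_lift (sP g gs); exists lc.
pose J := seq_sub s; pose L g := sval (cid (lift g)).
have LP (a : J) : pairs_set i (2 * k) (wreath (lift_sections i (val a) (L (val a))) 1%g).
  by rewrite /L; case: cid => lc /=; apply; exact: valP.
pose X (f : {ffun 'F_p -> J}) := (\prod_(0 <= m < p) (sg (-1) *
  wreath (lift_sections i (val (f m%:R)) (L (val (f m%:R)))) 1))%g.
pose junk (f : {ffun 'F_p -> J}) := [ffun x => L (val (f x))].
have inj : injective (fun f => (X f, junk f)).
  move=> f f' [EX /ffunP EJ]; apply/ffunP => x; apply/val_inj.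
  have {}EJ y : L (val (f y)) = L (val (f' y)) by have := EJ y; rewrite !ffunE.
  (* At the letter [x + 1], factor number [m] contributes its section at [x - m]. This is [f x] for
     [m = x]; the other factors only involve the side sections, which agree by [EJ]. *)
  move: EX; rewrite /X !shifted_prod => /wreath_inj [/(_ ((x : nat).+1%:R))].
  move=> /(@prodg_cancel _ _ _ _ _ (x : nat)); rewrite iota_uniq mem_index_iota.
  rewrite Fp_ltn natr_Zp => /(_ isT isT) E _.
  have {E} := E; rewrite subrr /lift_sections eqxx; apply => m.
  rewrite mem_index_iota => /andP [_ mp] mx.
  rewrite EJ -!natr1 opprD addrACA subrr addr0 subr_eq0 natr_Zp.
  rewrite -[X in X == _]natr_Zp (inj_in_eq natr_Fp_inj) ?inE ?Fp_ltn //.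
  by rewrite eq_sym (negbTE mx).
exists (undup (codom X)); split; first exact: undup_uniq.
  move=> g; rewrite mem_undup => /codomP [f ->].
  have := @pairs_set_prod i (2 * k) (index_iota 0 p); rewrite size_iota subn0.
  by apply=> m; apply: sg_pairs_set; rewrite ?muln_gt0.
have := card_codom_injective inj.
rewrite !card_ffun !card_prod card_Fp // card_seq_sub //.
rewrite -[(p * (p * p))%N]/(p ^ 3)%N => H.
rewrite -(@leq_pmul2r ((p ^ 3) ^ p)) ?expn_gt0 ?prime_gt0 //.
apply: leq_trans MN (leq_trans _ H).
by rewrite leq_exp2r // prime_gt0.
Qed.

(** The section at 0 separates the lifts of different elements, and the permutation of the first
    level separates their p translates by powers of sigma. Such a power is absorbed into the first
    factor, at no cost in length. *)
Lemma pairs_set_shift i k N : (0 < k)%N -> large (pairs_set (i + 1) k) N ->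
  large (pairs_set i (2 * k)) (p * N).
Proof.
move=> k0 [s [us sP Ns]].
have lift g : exists lc, g \in s -> pairs_set i (2 * k) (wreath (lift_sections i g lc) 1%g).
  have [gs|gs] := boolP (g \in s); last by exists 0.
  by have [lc lcP] := pairs_set_lift (sP g gs); exists lc.
pose L g := sval (cid (lift g)).
have LP g : g \in s -> pairs_set i (2 * k) (wreath (lift_sections i g (L g)) 1%g).
  by rewrite /L; case: cid.
exists [seq (sg a * wreath (lift_sections i g (L g)) 1)%g | a <- enum 'F_p, g <- s].
split.
- apply: allpairs_uniq; rewrite ?enum_uniq // => -[a g] [b h] /= _ _.
  rewrite !sg_wreath => /wreath_inj [E]; rewrite !mulg1 => /shift_inj ab.
  by move: E; rewrite ab => /(_ (- b)); rewrite addNr /lift_sections eqxx => ->.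
- by move=> _ /allpairsP [[a g] /= [_ gs ->]]; 
  by apply: sg_pairs_set; [rewrite muln_gt0|exact: LP].
- by rewrite size_allpairs -cardE card_Fp // leq_mul2l Ns orbT.
Qed.

Lemma pairs_set_unbounded t : exists2 k, (0 < k)%N & forall i, large (pairs_set i k) (p ^ t).
Proof.
elim: t => [|t [k k0 IHt]].
  exists 1%N => // i; exists [:: 1%g]; split=> // g; rewrite inE => /eqP ->.
  exists [:: 0] => //; rewrite /pairs_prod big_seq1 /=.
  by rewrite sg0 beta0 mulg1.
exists (2 * k)%N; first by rewrite muln_gt0.
by move=> i; rewrite expnS; apply: pairs_set_shift.
Qed.

Lemma large_pairs_set :
  exists2 k, (0 < k)%N & forall m i, large (pairs_set i (k * (2 * p) ^ m)) (4 ^ (p ^ m)).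
Proof.
(* The exponent 8 comes from (p^3)^2 4 <= p^8. *)
have [k k0 kP] := pairs_set_unbounded 8; exists k => // m.
have p0 := prime_gt0 p_prime.
(* The extra factor (p^3)^2 pays for the loss: its p-th power divided by (p^3)^p is (p^3)^p, which
   is at least (p^3)^2 again. *)
suff H i : large (pairs_set i (k * (2 * p) ^ m)) ((p ^ 3) ^ 2 * 4 ^ (p ^ m)).
  move=> i; have [s [us sP Ns]] := H i; exists s; split=> //; apply: leq_trans Ns.
  by rewrite leq_pmull // !expn_gt0 p0.
elim: m i => [|m IHm] i.
  have [s [us sP Ns]] := kP i; exists s; split; rewrite ?muln1 //.
  apply: leq_trans Ns; rewrite -expnM expn0 expn1 (expnD p 6 2) leq_mul2l.
  by rewrite (@leq_mul 2 2) ?orbT // ltnW.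
have := @pairs_set_power i _ _ ((p ^ 3) ^ 2 * 4 ^ p ^ m.+1) _ (IHm (i + 1)).
have -> : (2 * (k * (2 * p) ^ m) * p)%N = (k * (2 * p) ^ m.+1)%N.
  by rewrite expnS mulnCA -mulnA [in RHS]mulnAC mulnA mulnAC.
apply; first by rewrite muln_gt0 k0 expn_gt0 muln_gt0 p0.
rewrite expnMn -mulnAC (expnSr p m) (expnM 4) leq_mul2r; apply/orP; right.
rewrite -expnD -(expnM _ 2); apply: leq_pexp2l; first by rewrite expn_gt0 p0.
by rewrite mul2n -addnn leq_add2r ltnW.
Qed.

End LowerBound.

(** * The group generated by A and B at the second level *)

Section Words.
Variables (p : nat) (lam : 'Z_(p ^ 2) -> 'F_p * 'F_p).
Implicit Types (i : 'Z_(p ^ 2)) (s : seq ('F_p + 'F_p * 'F_p)).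

Definition letter_eval i (l : 'F_p + 'F_p * 'F_p) : tree_aut 'F_p :=
  match l with inl x => sg x | inr c => beta lam i c end.

Definition word_eval i s : tree_aut 'F_p := (\prod_(l <- s) letter_eval i l)%g.

Lemma word_eval_cons i l s :
  word_eval i (l :: s) = (letter_eval i l * word_eval i s)%g.
Proof. by rewrite /word_eval big_cons. Qed.

Lemma word_eval_cat i s t :
  word_eval i (s ++ t) = (word_eval i s * word_eval i t)%g.
Proof. by rewrite /word_eval big_cat. Qed.

Definition words i n : set (tree_aut 'F_p) :=
  [set g | exists2 s, (size s <= n)%N & g = word_eval i s].

Lemma words_letter i l : words i 1 (letter_eval i l).
Proof. by exists [:: l] => //; rewrite /word_eval big_seq1. Qed.

Lemma wordsM i n m g h :
  words i n g -> words i m h -> words i (n + m) (g * h)%g.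
Proof.
move=> [s sn ->] [t tm ->]; exists (s ++ t); last by rewrite word_eval_cat.
by rewrite size_cat leq_add.
Qed.

Lemma words1 i n : words i n 1%g.
Proof. by exists [::] => //; rewrite /word_eval big_nil. Qed.

Lemma wordsV i n g : words i n g -> words i n (g^-1)%g.
Proof.
have letterV l : exists l', (letter_eval i l)^-1%g = letter_eval i l'.
  by case: l => [x|c]; [exists (inl (- x))|exists (inr (- c))]; rewrite /= ?sgN ?betaN.
move=> [s + ->]; elim: s n => [|l s IHs] n.
  by rewrite /word_eval big_nil invg1 => _; exact: words1.
case: n => // n sn; rewrite word_eval_cons invgM -addn1.
apply: wordsM; first exact: IHs.
by have [l' ->] := letterV l; exact: words_letter.
Qed.

(** The permutations on the first two levels may be arbitrary: a portrait stores each of them as one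
    symbol. Only the lengths of the sections at level two matter. *)
Definition second_level n : set (tree_aut 'F_p) :=
  [set g | exists pi rho F,
    g = wreath (fun x => wreath (F x) (rho x)) pi /\ forall x y, words 1 n (F x y)].

Lemma second_level1 n : second_level n 1%g.
Proof.
exists 1%g, (fun=> 1%g), (fun _ _ => 1%g); split=> [|x y]; last exact: words1.
by rewrite wreath1 wreath1.
Qed.

Lemma second_levelM n m g h :
  second_level n g -> second_level m h -> second_level (n + m) (g * h)%g.
Proof.
move=> [pi [rho [F [-> FP]]]] [pi' [rho' [F' [-> FP']]]]; rewrite wreathM.
exists (pi * pi')%g, (fun x => rho x * rho' (pi x))%g,
  (fun x y => F x y * F' (pi x) (rho x y))%g; split; last by move=> x y; exact: wordsM.
by apply: eq_wreath => x; rewrite wreathM.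
Qed.

Lemma second_levelV n g : second_level n g -> second_level n (g^-1)%g.
Proof.
move=> [pi [rho [F [-> FP]]]]; rewrite wreathV.
exists (pi^-1)%g, (fun x => (rho (pi^-1 x))^-1)%g,
  (fun x y => (F (pi^-1 x) ((rho (pi^-1 x))^-1 y))^-1)%g.
split; last by move=> x y; exact: wordsV.
by apply: eq_wreath => x; rewrite wreathV.
Qed.

Lemma second_levelA : second_level 1 (sush_A p).
Proof.
exists (cycle_perm p), (@shift p), (fun _ _ => 1%g); split; last by move=> x y; exact: words1.
by apply: eq_wreath => x; rewrite -sgE.
Qed.

Lemma second_levelB : second_level 1 (sush_B lam).
Proof.
exists 1%g, (fun=> 1%g), (fun x y => if (x, y) == (0, 0) then sush_q lam 1
    else if (x, y) == (1, 0) then sush_r lam 1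
    else if (x, y) == (2%:R, 1) then sigma p else 1%g); split=> // x y.
case: ifP => _; first by rewrite sush_qE; exact: (words_letter _ (inr _)).
case: ifP => _; first by rewrite sush_rE; exact: (words_letter _ (inr _)).
case: ifP => _; last exact: words1.
by rewrite -[sigma p]expg1; exact: (words_letter _ (inl 1)).
Qed.

Lemma growth_ball_second_level n g :
  growth_ball [set sush_A p; sush_B lam] n g -> second_level n g.
Proof.
have genP x : [set sush_A p; sush_B lam] x -> second_level 1 x.
  by case=> ->; [exact: second_levelA|exact: second_levelB].
move=> [s [+ + ->]]; elim: s n => [|x s IHs] n.
  by rewrite big_nil => _ _; exact: second_level1.
case: n => // n sn sS; rewrite big_cons -add1n.
apply: second_levelM; last first.
  by apply: IHs => // y ys; apply: sS; rewrite in_cons ys orbT.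
case: (sS x (mem_head _ _)) => /genP // /second_levelV.
by rewrite invgK.
Qed.

Hypothesis p_prime : prime p.

(** Below the vertex 00 the element [h] acts as [g], hence determines it; this carries lower bounds
    from K_1 over to G. *)
Definition acts00 (h g : tree_aut 'F_p) : Prop :=
  forall w, h (0 :: 0 :: w) = 0 :: 0 :: g w.

Lemma acts00M h g h' g' : acts00 h g -> acts00 h' g' -> acts00 (h * h')%g (g * g')%g.
Proof. by move=> H H' w; rewrite !tree_autEM H H'. Qed.

Lemma acts00_1 : acts00 1%g 1%g.
Proof. by []. Qed.

Lemma acts00X h g n : acts00 h g -> acts00 (h ^+ n)%g (g ^+ n)%g.
Proof.
move=> H; elim: n => [|n IHn]; first exact: acts00_1.
by rewrite !expgS; apply: acts00M.
Qed.

Lemma sush_AE x y w : sush_A p (x :: y :: w) = x + 1 :: y + x :: w.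
Proof.
rewrite -[LHS]/(cycle_perm p x :: sg x (y :: w)) sgE /=.
by rewrite !permE.
Qed.

Lemma acts00_q : acts00 (sush_B lam) (sush_q lam 1).
Proof. by move=> w /=; rewrite !perm1. Qed.

(** [A] moves the vertex 00 to 10 and [A^2] moves it to 21. There [B] acts as [r_1] and as sigma, so
    conjugating [B] by these powers transports both actions to 00. *)
Lemma acts00_r : acts00 (sush_A p * sush_B lam * (sush_A p)^-1)%g (sush_r lam 1).
Proof.
move=> w; rewrite !tree_autEM sush_AE.
have -> : sush_B lam (0 + 1 :: 0 + 0 :: w) = sush_A p (0 :: 0 :: sush_r lam 1 w).
  by rewrite sush_AE /= !perm1 !add0r.
exact: tree_autK.
Qed.

Lemma acts00_sigma :
  acts00 (sush_A p ^+ 2 * sush_B lam * (sush_A p ^+ 2)^-1)%g (sigma p).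
Proof.
move=> w; rewrite expg2 !tree_autEM (sush_AE 0 0) (sush_AE (0 + 1)).
have -> : sush_B lam (0 + 1 + 1 :: 0 + 0 + (0 + 1) :: w) =
    (sush_A p * sush_A p)%g (0 :: 0 :: sigma p w).
  rewrite tree_autEM (sush_AE 0 0) (sush_AE (0 + 1)) /= !perm1 !add0r.
  by rewrite !xpair_eqE !oner_eq0 !andbF eqxx.
exact: tree_autK.
Qed.

Lemma acts00_pair : exists C, forall a : 'F_p * ('F_p * 'F_p), exists2 h,
  growth_ball [set sush_A p; sush_B lam] C h & acts00 h (sg a.1 * beta lam 1 a.2)%g.
Proof.
set S := [set sush_A p; sush_B lam].
have SA : growth_ball S 1 (sush_A p) by apply: growth_ball_gen; left.
have SB : growth_ball S 1 (sush_B lam) by apply: growth_ball_gen; right.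
(* The elements acting as sigma, [q_1] and [r_1] below 00 have lengths at most 5, 1 and 3, and all
   exponents are less than p. *)
exists (p * 5 + (p * 1 + p * 3))%N => -[x [y z]].
pose hr := (sush_A p * sush_B lam * (sush_A p)^-1)%g.
pose hs := (sush_A p ^+ 2 * sush_B lam * (sush_A p ^+ 2)^-1)%g.
have ballX (t : 'F_p) n h : growth_ball S n h -> growth_ball S (p * n) (h ^+ t)%g.
  move=> hn; apply: (@growth_ball_le _ _ (t * n)); last exact: growth_ballX.
  by rewrite leq_mul2r ltnW ?orbT // Fp_ltn.
exists (hs ^+ x * (sush_B lam ^+ y * hr ^+ z))%g; last first.
  apply: acts00M; first exact/acts00X/acts00_sigma.
  rewrite -[(x, (y, z)).2]/(y, z).
  have -> : (y, z) = (1, 0) *+ y + (0, 1) *+ z :> 'F_p * 'F_p.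
    rewrite -{1}[y]natr_Zp -{1}[z]natr_Zp; congr pair;
      by rewrite /= ?raddfMn /= ?mul0rn ?addr0 ?add0r.
  rewrite betaD -!betaX -sush_qE -sush_rE.
  by apply: acts00M; apply: acts00X; [exact: acts00_q|exact: acts00_r].
have SA2 : growth_ball S 2 (sush_A p ^+ 2)%g by apply: (growth_ballX 2) SA.
apply: growth_ballM; last apply: growth_ballM; apply: ballX => //.
  by apply: (@growth_ballM _ _ 3 2); [apply: (@growth_ballM _ _ 2 1)|exact: growth_ballV].
by apply: (@growth_ballM _ _ 2 1); [apply: (@growth_ballM _ _ 1 1)|exact: growth_ballV].
Qed.

Lemma large_pairs_growth : exists C, forall k N,
  large (pairs_set lam 1 k) N -> (N <= growth [set sush_A p; sush_B lam] (C * k))%N.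
Proof.
have [C CP] := acts00_pair; exists C => k N [s [us sP Ns]].
set S := [set sush_A p; sush_B lam].
have lift g : exists h, g \in s -> growth_ball S (C * k) h /\ acts00 h g.
  have [gs|gs] := boolP (g \in s); last by exists 1%g.
  have [t <- ->] := sP g gs.
  elim: t => [|a t [h /(_ isT) [hS hP]]].
    by exists 1%g; rewrite muln0 /pairs_prod big_nil; split=> //; exact: growth_ball1.
  have [h' h'S h'P] := CP a; exists (h' * h)%g => _.
  rewrite mulnS /pairs_prod big_cons; split; first exact: growth_ballM.
  exact: acts00M.
pose f g := sval (cid (lift g)).
have fP g : g \in s -> growth_ball S (C * k) (f g) /\ acts00 (f g) g.
  by rewrite /f; case: cid.
apply: leq_trans Ns _; rewrite -(size_map f); apply: size_leq_growth.
- by rewrite finite_setU; split; exact: finite_set1.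
- rewrite map_inj_in_uniq // => g h /fP [_ gP] /fP [_ hP] fgh.
  by apply: tree_aut_ext => w; have := gP w; rewrite fgh hP => -[].
- by move=> _ /mapP [g /fP [gS _] ->].
Qed.

End Words.

(** * Contracting weights *)

Section Weights.
Variables (R : realType) (p : nat) (lam : 'Z_(p ^ 2) -> 'F_p * 'F_p).
Hypotheses (p_prime : prime p) (p_gt2 : (2 < p)%N) (lam_bij : bijective lam).
Variable eta : R.
Hypotheses (eta_gt0 : 0 < eta) (eta_lt1 : eta < 1).
Hypothesis eta_root :
  eta ^+ (p ^ 2) + eta ^+ (p ^ 2 - 1) + eta ^+ (p ^ 2 - 2) = 2.
Implicit Types (i : 'Z_(p ^ 2)) (c d : 'F_p * 'F_p) (x : 'F_p).
Implicit Types (l : 'F_p + 'F_p * 'F_p) (s : seq ('F_p + 'F_p * 'F_p)).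
Local Notation r := (p ^ 2)%N.

Lemma sqr_gt2 : (2 < r)%N.
Proof. by apply: (leq_trans p_gt2); rewrite expnS expn1 leq_pmulr // prime_gt0. Qed.

Lemma phi_killed i c : exists2 k, (k < r)%N & phi lam (i + k%:R) c == 0.
Proof.
have [f _ fK] := lam_bij; exists (nat_of_ord (f c - i)).
  by rewrite -[X in (_ < X)%N](@Zp_cast r) ?(ltnW sqr_gt2) // ltn_ord.
by rewrite natr_Zp addrC subrK -{2}[c]fK phi_lam.
Qed.

Lemma ex_phi_killed i c : exists k, phi lam (i + k%:R) c == 0.
Proof. by have [k _ kP] := phi_killed i c; exists k. Qed.

Definition death i c : nat := ex_minn (ex_phi_killed i c).
Arguments death (i c)%_R.

Lemma deathP i c : phi lam (i + (death i c)%:R) c = 0.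
Proof. by rewrite /death; case: ex_minnP => k /eqP. Qed.

Lemma death_min i c k : phi lam (i + k%:R) c = 0 -> (death i c <= k)%N.
Proof. by rewrite /death; case: ex_minnP => m _ mP /eqP /mP. Qed.

Lemma death_lt i c : (death i c < r)%N.
Proof.
by have [k kr /eqP /death_min kP] := phi_killed i c; apply: leq_ltn_trans kr.
Qed.

Lemma death_gt0 i c : phi lam i c != 0 -> (0 < death i c)%N.
Proof.
by apply: contra_neqT; rewrite -eqn0Ngt => /eqP E; have := deathP i c; rewrite E addr0.
Qed.

Lemma death_succ i c : phi lam i c != 0 -> (death (i + 1) c <= (death i c).-1)%N.
Proof.
move=> /death_gt0 d0; apply: death_min.
by rewrite -addrA [1 + _]addrC natr1 prednK // deathP.
Qed.

(* With w_t := [death_weight t] the weight of the [beta i c] with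
   [death i c = t] and w := [sigma_weight] that of the nontrivial powers of
   sigma, these values solve
   w_t + w = eta (w_(t+1) + w) and w_(r-1) = eta (w_0 + w); the equation for eta
   is then equivalent to w_(r-1) = w_0 + w_1, the critical case of the triangle
   inequality. *)
Definition sigma_weight : R := 1 - eta ^+ r.

Definition death_weight (t : nat) : R := eta ^+ (r - 1 - t) - sigma_weight.

Lemma sigma_weight_gt0 : 0 < sigma_weight.
Proof.
by rewrite subr_gt0 exprn_ilt1 ?(ltW eta_gt0) // -lt0n (ltnW (ltnW sqr_gt2)).
Qed.

Lemma death_weight_homo t t' : (t <= t')%N -> death_weight t <= death_weight t'.
Proof.
move=> tt'; rewrite lerD2r; apply: ler_wiXn2l; rewrite ?ltW //.
by rewrite leq_sub2l.
Qed.

(** By the equation for [eta], this weight equals 1 - eta^(r-2). *)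
Lemma death_weight0_gt0 : 0 < death_weight 0.
Proof.
have r3 : (0 < r - 2)%N by rewrite subn_gt0 sqr_gt2.
have : eta ^+ (r - 2) < 1 by rewrite exprn_ilt1 ?(ltW eta_gt0) ?eta_lt1 // -lt0n.
by rewrite /death_weight /sigma_weight subn0; have := eta_root; lra.
Qed.

Lemma death_weight_ge0 t : 0 <= death_weight t.
Proof. by apply: le_trans (death_weight_homo (leq0n t)); exact: ltW death_weight0_gt0. Qed.

Lemma death_weight_step t : (t.+1 < r)%N ->
  death_weight t + sigma_weight = eta * (sigma_weight + death_weight t.+1).
Proof.
move=> tr; rewrite /death_weight subrK addrC subrK -exprS; congr (_ ^+ _).
by rewrite (subnS (r - 1) t) prednK // subn_gt0 ltn_subRL add1n.
Qed.

Lemma death_weight_wrap : death_weight (r - 1) = eta * (sigma_weight + death_weight 0).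
Proof.
rewrite /death_weight subnn subn0 expr0 [sigma_weight + _]addrC subrK -exprS.
by rewrite subn1 prednK ?(ltnW (ltnW sqr_gt2)) // /sigma_weight opprB addrC subrK.
Qed.

Lemma death_weight_sum : death_weight (r - 1) = death_weight 0 + death_weight 1.
Proof.
rewrite /death_weight subnn subn0 expr0 -subnDA addn1 /sigma_weight.
by have := eta_root; lra.
Qed.

Definition letter_weight i l : R :=
  match l with
  | inl x => if x == 0 then 0 else sigma_weight
  | inr c => if c == 0 then 0 else death_weight (death i c)
  end.

Definition weight i s : R := \sum_(l <- s) letter_weight i l.

Lemma letter_weight_ge0 i l : 0 <= letter_weight i l.
Proof.
by case: l => [x|c] /=; case: eqP => // _; rewrite ?death_weight_ge0 ?ltW ?sigma_weight_gt0.
Qed.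

Lemma weight_ge0 i s : 0 <= weight i s.
Proof. by apply: sumr_ge0 => l _; exact: letter_weight_ge0. Qed.

Lemma weight_cons i l s : weight i (l :: s) = letter_weight i l + weight i s.
Proof. by rewrite /weight big_cons. Qed.

Lemma letter_weightD_inl i x y :
  letter_weight i (inl (x + y)) <= letter_weight i (inl x) + letter_weight i (inl y).
Proof.
have w0 := ltW sigma_weight_gt0; rewrite /=.
have [->|x0] := eqVneq x 0; first by rewrite !add0r.
by have [->|y0] := eqVneq y 0; [rewrite !addr0 (negbTE x0)|case: eqP => _; lra].
Qed.

(* Two elements dying at different times weigh at least w_0
   and w_1, so [death_weight_sum] gives the inequality; if they die
   together, so does their sum. *)
Lemma letter_weightD_inr i c d :
  letter_weight i (inr (c + d)) <= letter_weight i (inr c) + letter_weight i (inr d).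
Proof.
rewrite /=.
have [->|c0] := eqVneq c 0; first by rewrite !add0r.
have [->|d0] := eqVneq d 0; first by rewrite !addr0 (negbTE c0).
case: eqP => _; first by rewrite addr_ge0 ?death_weight_ge0.
have top : death_weight (death i (c + d)) <= death_weight (r - 1).
  by apply: death_weight_homo; rewrite subn1 -ltnS prednK ?death_lt // (ltnW (ltnW sqr_gt2)).
have [E|] := eqVneq (death i c) (death i d).
  apply: (@le_trans _ _ (death_weight (death i c))); last by rewrite lerDl death_weight_ge0.
  by apply/death_weight_homo/death_min; rewrite phiD deathP E deathP addr0.
rewrite neq_ltn => /orP [] lt; apply: (le_trans top); rewrite death_weight_sum.
  by apply: lerD; apply: death_weight_homo => //; apply: leq_ltn_trans lt.
by rewrite addrC; apply: lerD; apply: death_weight_homo => //; apply: leq_ltn_trans lt.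
Qed.

(** If [phi] kills [c] now, only the section at 0 survives; its new waiting time is arbitrary, so it
    is bounded by the largest weight, using [death_weight_wrap]. Otherwise a power of sigma appears,
    but the waiting time drops by at least one, and [death_weight_step] applies. *)
Lemma letter_weight_sections i c : c != 0 ->
  letter_weight (i + 1) (inr c) + letter_weight (i + 1) (inl (phi lam i c)) <=
  eta * (sigma_weight + letter_weight i (inr c)).
Proof.
move=> c0; rewrite /= (negbTE c0); case: eqVneq => [_|nz].
  rewrite addr0; apply: (@le_trans _ _ (death_weight (r - 1))).
    by apply: death_weight_homo; rewrite subn1 -ltnS prednK ?death_lt // (ltnW (ltnW sqr_gt2)).
  by rewrite death_weight_wrap ler_wpM2l ?(ltW eta_gt0) // lerD2l death_weight_homo.
have d0 := death_gt0 nz.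
rewrite -(prednK d0) -death_weight_step ?prednK ?death_lt // lerD2r.
exact/death_weight_homo/death_succ.
Qed.

Definition nontrivial l : bool :=
  match l with inl x => x != 0 | inr c => c != 0 end.

Definition alternate l l' : bool :=
  match l, l' with inl _, inr _ | inr _, inl _ => true | _, _ => false end.

Definition reduced s : bool := all nontrivial s && sorted alternate s.

Lemma reduced_behead l s : reduced (l :: s) -> reduced s.
Proof. by rewrite /reduced /= => /andP [/andP [_ ->]] /path_sorted. Qed.

Lemma reduced_swap l l' s : nontrivial l -> alternate l =1 alternate l' ->
  reduced (l' :: s) -> reduced (l :: s).
Proof.
rewrite /reduced /= => -> E /andP [/andP [_ ->]] /=.
by case: s => //= m s; rewrite E.
Qed.

(** Merging [l] with a first letter of the same kind does not raise the weight, by the triangle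
    inequalities. The merged letter is of that kind too, so it alternates with the rest and no
    further merging is needed. *)
Lemma reduce_cons i l s : reduced s -> exists t, [/\ reduced t,
  word_eval lam i t = word_eval lam i (l :: s) & weight i t <= weight i (l :: s)].
Proof.
move=> sred; have [lnt|lt] := boolP (nontrivial l); last first.
  exists s; rewrite word_eval_cons weight_cons; split=> //.
    by case: l lt => [x|c] /=; rewrite negbK => /eqP ->; rewrite ?sg0 ?beta0 mul1g.
  by rewrite lerDr letter_weight_ge0.
case: s sred => [|m s] sred.
  by exists [:: l]; split=> //; rewrite /reduced /= lnt.
have [alt|] := boolP (alternate l m).
  by exists [:: l, m & s]; split=> //; move: sred; rewrite /reduced /= lnt alt.
have sred' := reduced_behead sred.
case: l m lnt sred => [x|c] [y|d] //= lnt sred _.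
  have [xy0|xy] := eqVneq (x + y) 0.
    exists s; rewrite !word_eval_cons !weight_cons mulgA; split=> //.
      by rewrite /= -sgD xy0 sg0 mul1g.
    by rewrite addrA lerDr addr_ge0 ?letter_weight_ge0.
  exists (inl (x + y) :: s); rewrite !word_eval_cons !weight_cons; split.
  - exact: reduced_swap sred.
  - by rewrite mulgA /= sgD.
  - by rewrite addrA lerD2r letter_weightD_inl.
have [cd0|cd] := eqVneq (c + d) 0.
  exists s; rewrite !word_eval_cons !weight_cons mulgA; split=> //.
    by rewrite /= -betaD cd0 beta0 mul1g.
  by rewrite addrA lerDr addr_ge0 ?letter_weight_ge0.
exists (inr (c + d) :: s); rewrite !word_eval_cons !weight_cons; split.
- exact: reduced_swap sred.
- by rewrite mulgA /= betaD.
- by rewrite addrA lerD2r letter_weightD_inr.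
Qed.

Lemma reduce i s : exists t, [/\ reduced t,
  word_eval lam i t = word_eval lam i s & weight i t <= weight i s].
Proof.
elim: s => [|l s [t [tred tE tw]]]; first by exists [::].
have [t' [t'red t'E t'w]] := reduce_cons i l tred.
exists t'; split=> //; first by rewrite t'E !word_eval_cons tE.
by apply: (le_trans t'w); rewrite !weight_cons lerD2l.
Qed.

Definition min_weight : R := Num.min sigma_weight (death_weight 0).

Lemma min_weight_gt0 : 0 < min_weight.
Proof. by rewrite lt_min sigma_weight_gt0 death_weight0_gt0. Qed.

Lemma reduced_size i s : reduced s -> min_weight *+ size s <= weight i s.
Proof.
elim: s => [|l s IHs] /= lred; first by rewrite /weight big_nil.
rewrite weight_cons mulrS; apply: lerD; last exact/IHs/(reduced_behead lred).
move: lred => /andP [/andP [/= lnt _] _]; rewrite ge_min.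
by case: l lnt => [x|c] /= /negbTE ->; rewrite ?lexx // death_weight_homo // orbT.
Qed.

(** Each [beta] letter is charged together with one power of sigma; this is the quantity that
    passing to sections contracts by [eta]. *)
Definition beta_cost i s : R :=
  \sum_(l <- s) (if l is inr _ then sigma_weight + letter_weight i l else 0).

Lemma beta_cost_reduced i s : reduced s -> beta_cost i s <= weight i s + sigma_weight.
Proof.
have w0 := sigma_weight_gt0; move=> sred.
(* By alternation every [beta] letter but a leading one can be charged to the power of sigma before
   it, so the surplus occurs only for words beginning with a [beta] letter. *)
suff : beta_cost i s <= weight i s + (if s is inr _ :: _ then sigma_weight else 0).
  by move=> /le_trans; apply; case: s {sred} => [|[x|c] s]; rewrite lerD2l ?lexx // ltW.
elim: s sred => [|l s IHs] lred.
  by rewrite /beta_cost /weight !big_nil addr0.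
have {IHs} := IHs (reduced_behead lred).
rewrite /beta_cost big_cons -/(beta_cost i s) weight_cons.
move: lred; case: l => [x|c] /andP [/andP [nt _]].
  rewrite /= (negbTE nt); case: s => [|[y|d] s] //= _; lra.
by case: s => [|[y|d] s] //= _; lra.
Qed.

(** The argument [x] follows the image of the original letter under the prefix already read. *)
Fixpoint section_word i s x : seq ('F_p + 'F_p * 'F_p) :=
  match s with
  | [::] => [::]
  | inl y :: s' => section_word i s' (x + y)
  | inr c :: s' => (if x == 0 then [:: inr c] else
      if x == 1 then [:: inl (phi lam i c)] else [::]) ++ section_word i s' x
  end.

Lemma word_eval_sections i s : exists y, word_eval lam i s =
  wreath (fun x => word_eval lam (i + 1) (section_word i s x)) (shift y).
Proof.
elim: s => [|[y|c] s [z IHs]].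
- exists 0; rewrite shift0 /word_eval big_nil -[LHS]wreath1.
  by apply: eq_wreath => x; rewrite /= big_nil.
- by exists (y + z); rewrite word_eval_cons IHs /= sg_wreath shiftD.
- exists z; rewrite word_eval_cons IHs /= betaE wreathM mul1g.
  apply: eq_wreath => x; rewrite perm1 word_eval_cat; congr (_ * _)%g.
  by do 2?[case: ifP => _]; rewrite /word_eval ?big_seq1 ?big_nil.
Qed.

(** Powers of sigma merely permute the sections, which reindexes the sum; each [beta] letter
    contributes only to the sections at 0 and at 1. *)
Lemma weight_sections i s : all nontrivial s ->
  \sum_x weight (i + 1) (section_word i s x) <= eta * beta_cost i s.
Proof.
elim: s => [|l s IHs] /=.
  move=> _; rewrite /beta_cost big_nil mulr0 big1 // => x _.
  by rewrite /weight big_nil.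
case: l => [y|c] /andP [nt /IHs {}IHs]; rewrite /beta_cost big_cons -/(beta_cost i s).
  rewrite add0r (reindex_inj (addIr (- y))) /=.
  by under eq_bigr => x _ do rewrite subrK.
rewrite mulrDr; apply: le_trans (lerD (letter_weight_sections i nt) IHs).
have E x : weight (i + 1) ((if x == 0 then [:: inr c] else
      if x == 1 then [:: inl (phi lam i c)] else [::]) ++ section_word i s x) =
    (if x == 0 then letter_weight (i + 1) (inr c) else 0) +
    (if x == 1 then letter_weight (i + 1) (inl (phi lam i c)) else 0) +
    weight (i + 1) (section_word i s x).
  rewrite /weight big_cat /=; congr (_ + _).
  have [->|x0] := eqVneq x 0.
    by rewrite big_seq1 [0 == 1]eq_sym (negbTE (oner_neq0 _)) addr0.
  by rewrite add0r; case: ifP => _; rewrite ?big_seq1 ?big_nil.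
rewrite (eq_bigr _ (fun x _ => E x)) !big_split /= -!big_mkcond /=.
by rewrite !big_pred1_eq.
Qed.

Lemma contraction i s : exists (F : 'F_p -> seq ('F_p + 'F_p * 'F_p)) pi,
  word_eval lam i s = wreath (fun x => word_eval lam (i + 1) (F x)) pi /\
  \sum_x weight (i + 1) (F x) <= eta * (weight i s + sigma_weight).
Proof.
have [t [tred <- tw]] := reduce i s; have [y ->] := word_eval_sections i t.
exists (section_word i t), (shift y); split=> //.
have /andP [tnt _] := tred.
apply: (le_trans (weight_sections i tnt)); rewrite ler_pM2l //.
by apply: (le_trans (beta_cost_reduced i tred)); rewrite lerD2r.
Qed.

Lemma weight_words i s K : weight i s <= min_weight *+ K ->
  words lam i K (word_eval lam i s).
Proof.
have [t [tred <- tw]] := reduce i s; move=> sK; exists t => //.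
have := le_trans (reduced_size i tred) (le_trans tw sK).
by rewrite ler_pMn2l // min_weight_gt0.
Qed.

Definition max_letter_weight : R := sigma_weight + death_weight (r - 1).

Lemma weight_le_size i s : weight i s <= max_letter_weight *+ size s.
Proof.
elim: s => [|l s IHs]; first by rewrite /weight big_nil.
rewrite weight_cons mulrS; apply: lerD IHs.
have w0 := ltW sigma_weight_gt0; have W0 := death_weight_ge0 (r - 1).
case: l => [x|c] /=; case: eqP => _; rewrite /max_letter_weight.
- exact: (addr_ge0 w0 W0).
- by rewrite lerDl.
- exact: (addr_ge0 w0 W0).
apply: (@le_trans _ _ (death_weight (r - 1))); last by rewrite lerDr.
by apply: death_weight_homo; rewrite subn1 -ltnS prednK ?death_lt // (ltnW (ltnW sqr_gt2)).
Qed.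

(** Collects all that the portrait argument uses about the weight. *)
Lemma contracting_weight : exists (w : 'Z_r -> seq ('F_p + 'F_p * 'F_p) -> R) (a b m : R),
  [/\ 0 <= a, 0 < m, forall i s, 0 <= w i s,
      forall i s, w i s <= b *+ size s
    & forall i s K, w i s <= m *+ K -> words lam i K (word_eval lam i s)] /\
  forall i s, exists (F : 'F_p -> seq ('F_p + 'F_p * 'F_p)) pi,
    word_eval lam i s = wreath (fun x => word_eval lam (i + 1) (F x)) pi /\
    \sum_x w (i + 1) (F x) <= eta * (w i s + a).
Proof.
exists weight, sigma_weight, max_letter_weight, min_weight; split; last exact: contraction.
split; first exact: ltW sigma_weight_gt0.
- exact: min_weight_gt0.
- exact: weight_ge0.
- exact: weight_le_size.
- by move=> i s K; exact: weight_words.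
Qed.

End Weights.

(** * Portraits and the upper bound *)

Section Codes.
Variables (X E : finType) (atom : E -> tree_aut X).
Implicit Types (st : seq (tree_aut X)).

(* Portraits are encoded in prefix notation and evaluated by a stack machine
   reading from the right; [None] is padding. *)
Definition push (l : option (E + {perm X})) st : seq (tree_aut X) :=
  match l with
  | None => st
  | Some (inl e) => atom e :: st
  | Some (inr pi) =>
      wreath (fun x => nth 1%g st (index x (enum X))) pi :: drop #|X| st
  end.

(** Requiring the result over every initial stack makes codes stackable by concatenation. *)
Definition code n (g : tree_aut X) : Prop :=
  exists2 s, (size s <= n)%N & forall st, foldr push st s = g :: st.

Lemma code_atom e : code 1 (atom e).
Proof. by exists [:: Some (inl e)]. Qed.

Lemma code_le m n g : (m <= n)%N -> code m g -> code n g.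
Proof. by move=> mn [s sm sP]; exists s => //; apply: leq_trans mn. Qed.

Lemma code_wreath (N : X -> nat) (F : X -> tree_aut X) pi :
  (forall x, code (N x) (F x)) -> code (\sum_x N x).+1 (wreath F pi).
Proof.
move=> FP.
have /choice [S SP] x : exists s, (size s <= N x)%N /\
    forall st, foldr push st s = F x :: st.
  by have [s] := FP x; exists s.
exists (Some (inr pi) :: flatten [seq S x | x <- enum X]) => [|st] /=.
  rewrite ltnS size_flatten /shape -map_comp sumnE big_map big_enum /=.
  by apply: leq_sum => x _; have [] := SP x.
have -> (e : seq X) : foldr push st (flatten (map S e)) = map F e ++ st.
  elim: e => //= x e IHe; rewrite foldr_cat IHe.
  by have [_ ->] := SP x.
rewrite drop_size_cat; last by rewrite size_map -cardE.
congr (_ :: _).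
apply: eq_wreath => x; rewrite nth_cat size_map index_mem mem_enum.
by rewrite (nth_map x) ?index_mem ?mem_enum // nth_index ?mem_enum.
Qed.

Lemma code_tuple n : exists f : n.-tuple (option (E + {perm X})) -> tree_aut X,
  forall g, code n g -> exists t, g = f t.
Proof.
exists (fun t => head 1%g (foldr push [::] t)) => g [s sn sP].
(* The padding stands on the right, where it is read first and leaves the stack empty. *)
have padP : size (s ++ nseq (n - size s) None) == n.
  by rewrite size_cat size_nseq subnKC.
exists (Tuple padP); rewrite /= foldr_cat.
by rewrite (_ : foldr push [::] _ = [::]) ?sP //; elim: (n - size s)%N.
Qed.

End Codes.

(** * Concavity estimates for powers with exponent between 0 and 1 *)

Section PowerInequalities.
Variable R : realType.
Implicit Types (b x y m eps : R).

(** Young's inequality for the product of [y^b] and 1, with conjugate exponents 1/b and 1/(1-b). *)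
Lemma powR_le_affine b y : 0 < b < 1 -> 0 <= y -> y `^ b <= b * y + (1 - b).
Proof.
move=> /andP [b0 b1] y0; have b1' : 0 < 1 - b by rewrite subr_gt0.
have := @conjugate_powR R (y `^ b) 1 b^-1 (1 - b)^-1 (powR_ge0 _ _) ler01.
rewrite !invr_gt0 !invrK b0 b1' addrC subrK => /(_ isT isT erefl).
by rewrite mulr1 powR1 -powRrM divff ?gt_eqF // powRr1 // mulrC mul1r.
Qed.

Lemma powR_le_tangent b m y : 0 < b < 1 -> 0 < m -> 0 <= y ->
  y `^ b <= m `^ b * (b * (y / m) + (1 - b)).
Proof.
move=> b01 m0 y0; have ym : 0 <= y / m by rewrite divr_ge0 // ltW.
have {1}-> : y = m * (y / m) by rewrite mulrC divfK ?gt_eqF.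
rewrite powRM ?(ltW m0) // ler_wpM2l ?powR_ge0 //.
exact: powR_le_affine.
Qed.

(** Jensen's inequality, by summing the tangent bounds at the mean value [S / #|I|]. *)
Lemma sum_powR_le (I : finType) b (y : I -> R) S : 0 < b < 1 -> 0 < S ->
  (forall i, 0 <= y i) -> \sum_i y i <= S ->
  \sum_i y i `^ b <= #|I|%:R * (S / #|I|%:R) `^ b.
Proof.
move=> b01 S0 y0 yS; have [I0|I0] := posnP #|I|.
  by rewrite big1 ?I0 ?mul0r // => i _; have := card0_eq I0 i.
have N0 : 0 < #|I|%:R :> R by rewrite ltr0n.
set N := #|I|%:R in N0 *; set m := S / N.
have m0 : 0 < m by rewrite divr_gt0.
apply: (@le_trans _ _ (\sum_i m `^ b * (b * (y i / m) + (1 - b)))).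
  by apply: ler_sum => i _; exact: powR_le_tangent.
rewrite -mulr_sumr big_split /= -mulr_sumr -mulr_suml sumr_const -mulr_natl -/N.
rewrite mulrC ler_wpM2r ?powR_ge0 //.
have : (\sum_i y i) / m <= N.
  by rewrite ler_pdivrMr // /m mulrC divfK // gt_eqF.
move: b01 => /andP [b0 b1]; move: (_ / m) => t tN; nra.
Qed.

Lemma powR_sublinear b eps : 0 < b < 1 -> 0 < eps ->
  exists2 M, 0 < M & forall m, M <= m -> m `^ b <= eps * m.
Proof.
move=> /andP [b0 b1] e0; have b1' : 0 < 1 - b by rewrite subr_gt0.
exists (eps^-1 `^ (1 - b)^-1); first by rewrite powR_gt0 // invr_gt0.
move=> m Mm; have m0 : 0 < m by apply: lt_le_trans Mm; rewrite powR_gt0 // invr_gt0.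
have -> : eps * m = m `^ b * (eps * m `^ (1 - b)).
  rewrite mulrCA -powRD; last by rewrite (gt_eqF m0) implybT.
  by rewrite addrC subrK powRr1 // ltW.
rewrite ler_peMr ?powR_ge0 // -ler_pdivrMl // mulr1.
have := @ge0_ler_powR R (1 - b) (ltW b1') _ _ _ _ Mm.
rewrite -powRrM mulVf ?gt_eqF // powRr1 ?invr_ge0 ?(ltW e0) //.
by apply; rewrite nnegrE ?powR_ge0 ?(ltW m0).
Qed.

(** The tangent at [x] bounds the increment by b z x^(b-1), which tends to 0. *)
Lemma powR_shift b z : 0 < b < 1 -> 0 <= z ->
  exists2 M, 0 <= M & forall x, M <= x -> (x + z) `^ b <= x `^ b + 2^-1.
Proof.
move=> b01 z0.
have e0 : 0 < (2 * (z + 1))^-1 :> R by rewrite invr_gt0 mulr_gt0 // ltr_wpDl.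
have [M M0 MP] := powR_sublinear b01 e0; exists M; first exact: ltW.
move=> x Mx; have x0 : 0 < x by apply: lt_le_trans Mx.
apply: (le_trans (powR_le_tangent b01 x0 (addr_ge0 (ltW x0) z0))).
have := MP x Mx; have := powR_ge0 x b; set t := x `^ b => t0 tx.
have -> : b * ((x + z) / x) + (1 - b) = 1 + b * z / x by field; rewrite gt_eqF.
rewrite mulrDr mulr1 lerD2l.
have : t / x <= (2 * (z + 1))^-1 by rewrite ler_pdivrMr.
have -> : t * (b * z / x) = (t / x) * (b * z) by field; rewrite gt_eqF.
move: (t / x) (divr_ge0 t0 (ltW x0)) => u u0 uz.
have : u * (2 * (z + 1)) <= 1.
  by rewrite -ler_pdivlMr ?mul1r // mulr_gt0 // ltr_wpDl.
by move: b01 => /andP [b0 b1]; nra.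
Qed.

End PowerInequalities.

(** * Size of portraits and the resulting upper bound *)

Section UpperBound.
Variables (R : realType) (p : nat) (lam : 'Z_(p ^ 2) -> 'F_p * 'F_p).
Hypotheses (p_prime : prime p) (p_gt2 : (2 < p)%N) (lam_bij : bijective lam).
Variables eta b : R.
Hypotheses (eta_gt0 : 0 < eta) (eta_lt1 : eta < 1).
Hypothesis eta_root :
  eta ^+ (p ^ 2) + eta ^+ (p ^ 2 - 1) + eta ^+ (p ^ 2 - 2) = 2.
Hypotheses (b01 : 0 < b < 1) (b_eta : p%:R * (eta / p%:R) `^ b = 1).

Definition short_word K (e : 'Z_(p ^ 2) * K.-bseq ('F_p + 'F_p * 'F_p)%type) :
  tree_aut 'F_p := word_eval lam e.1 e.2.

Lemma code_word : exists K B, 0 <= B /\ forall i s, exists2 n,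
  n%:R <= 2 * (B *+ size s + 1 : R) `^ b - 1 & code (@short_word K) n (word_eval lam i s).
Proof.
have [w [a [B [m [[a0 m0 w0 wB wK] wF]]]]] :=
  contracting_weight p_prime p_gt2 lam_bij eta_gt0 eta_lt1 eta_root.
have pR : 0 < p%:R :> R by rewrite ltr0n prime_gt0.
have p3 : 3 <= p%:R :> R by rewrite ler_nat.
have b0 : 0 <= b by case/andP: b01 => /ltW.
have ep : eta <= p%:R by move: p3 eta_lt1; lra.
(* The shift to be absorbed: Jensen and [b_eta] bound the sum of the (w_x + 1)^b over the sections
   by (w + a + p/eta)^b. *)
have z0 : 0 <= a + p%:R / eta - 1.
  have : 1 <= p%:R / eta by rewrite ler_pdivlMr // mul1r.
  lra.
have [M M0 MP] := powR_shift b01 z0.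
have e1 : 0 < 1 - eta by rewrite subr_gt0.
(* Above this threshold [eta (w + a) <= w - 1], so each section weighs at least one less, and
   [powR_shift] applies. *)
pose k := M + (eta * a + 1) / (1 - eta).
have q0 : 0 <= (eta * a + 1) / (1 - eta).
  by apply: divr_ge0 (ltW e1); rewrite addr_ge0 // mulr_ge0 // ltW.
have kM : M <= k by rewrite lerDl.
have k0 := le_trans M0 kM.
have ke : eta * a + 1 <= k * (1 - eta).
  by rewrite -ler_pdivrMr // lerDr.
(* Elements of weight at most [k] are words of at most [K] letters; these finitely many words are
   the leaves of the portraits. *)
pose K := Num.bound (k / m).
have kK : k <= m *+ K.
  by rewrite -mulr_natl -ler_pdivrMr // ltW // archi_boundP // divr_ge0 // ltW.
exists K, `|B|; split=> // i s.
suff [n nw nc] : exists2 n,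
    n%:R <= 2 * (w i s + 1) `^ b - 1 & code (@short_word K) n (word_eval lam i s).
  exists n => //; apply: (le_trans nw); rewrite lerD2r ler_pM2l //.
  apply: ge0_ler_powR; rewrite ?nnegrE ?addr_ge0 ?mulrn_wge0 //.
  by rewrite lerD2r (le_trans (wB i s)) // lerMn2r ler_norm orbT.
have short i' s' : w i' s' <= k -> exists2 n, n%:R <= 2 * (w i' s' + 1) `^ b - 1
    & code (@short_word K) n (word_eval lam i' s').
  move=> wk; exists 1%N.
    have : 1 <= (w i' s' + 1) `^ b.
      by rewrite -[leLHS](powRr0 (w i' s' + 1)) ler_powR // lerDr.
    lra.
  have [t tK ->] := wK i' s' K (le_trans wk kK).
  exact: (@code_atom _ _ (@short_word K) (i', Bseq tK)).
have wd : w i s <= k + (Num.bound (w i s))%:R.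
  by rewrite (le_trans (ltW (archi_boundP (w0 i s)))) // lerDr.
move: (Num.bound (w i s)) wd => d; elim: d i s => [|d IHd] i s wd.
  by apply: short; rewrite addr0 in wd.
have [/short //|kw] := leP (w i s) k.
have [F [pi [-> FP]]] := wF i s.
have wi0 := w0 i s.
have wFx x : w (i + 1) (F x) <= k + d%:R.
  apply: (@le_trans _ _ (eta * (w i s + a))).
    by apply: le_trans FP; rewrite (bigD1 x) //= lerDl sumr_ge0.
  have : k * (1 - eta) <= w i s * (1 - eta) by rewrite ler_pM2r // ltW.
  by move: wd ke; rewrite -natr1; lra.
have /choice [N NP] x : exists n, n%:R <= 2 * (w (i + 1) (F x) + 1) `^ b - 1 /\
    code (@short_word K) n (word_eval lam (i + 1) (F x)).
  by have [n nw nc] := IHd _ _ (wFx x); exists n.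
exists (\sum_x N x).+1; last by apply: code_wreath => x; have [] := NP x.
rewrite -natr1 natr_sum.
have sumN : \sum_x (N x)%:R <= \sum_x (2 * (w (i + 1) (F x) + 1) `^ b - 1).
  by apply: ler_sum => x _; have [] := NP x.
move: sumN; rewrite sumrB -mulr_sumr sumr_const card_Fp // => sumN.
have := @sum_powR_le R 'F_p b (fun x => w (i + 1) (F x) + 1)
  (eta * (w i s + a) + p%:R) b01.
rewrite card_Fp // => H.
have {}H : \sum_x (w (i + 1) (F x) + 1) `^ b <= (w i s + 1 + (a + p%:R / eta - 1)) `^ b.
  apply: (le_trans (H _ _ _)).
  - by rewrite ltr_wpDl // mulr_ge0 ?addr_ge0 // ltW.
  - by move=> x; rewrite addr_ge0.
  - by rewrite big_split /= sumr_const card_Fp // lerD2r.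
  have -> : (eta * (w i s + a) + p%:R) / p%:R =
      (eta / p%:R) * (w i s + 1 + (a + p%:R / eta - 1)).
    by field; rewrite !gt_eqF.
  rewrite powRM ?divr_ge0 ?(ltW eta_gt0) ?(ltW pR) //; last first.
    by rewrite addr_ge0 // addr_ge0.
  by rewrite mulrA b_eta mul1r.
(* Twice the slack 1/2, plus one for the root, minus p for the sections: the total is at most -1
   because p >= 3, which restores the bound. *)
have := MP (w i s + 1) _.
have -> : M <= w i s + 1 by move: kM kw; lra.
move=> /(_ isT); move: H sumN p3; lra.
Qed.

Lemma growth_upper_bound : exists2 C : R, 0 <= C & forall n, (0 < n)%N ->
  (growth [set sush_A p; sush_B lam] n)%:R <= expR (C * n%:R `^ b).
Proof.
have [K [B [B0 codeP]]] := code_word.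
have b0 : 0 <= b by case/andP: b01 => /ltW.
(* One symbol for the root, p for the first level, and p^2 portraits at level two; the factor n^b >=
   1 absorbs the constants. *)
pose D : R := 1 + p%:R + p%:R * p%:R * (2 * (B + 1) `^ b).
have D0 : 0 <= D by rewrite !addr_ge0 ?mulr_ge0 ?powR_ge0.
set A := option ('Z_(p ^ 2) * K.-bseq ('F_p + 'F_p * 'F_p)%type + {perm 'F_p}).
have A1 : 1 <= #|{: A}|%:R :> R by rewrite ler1n; apply/card_gt0P; exists None.
exists (ln #|{: A}|%:R * D) => [|n n0]; first by rewrite mulr_ge0 // ln_ge0.
set S := [set sush_A p; sush_B lam].
have S_fin : finite_set S by rewrite finite_setU; split; exact: finite_set1.
have n1 : 1 <= n%:R `^ b :> R.
  by rewrite -[leLHS](powRr0 n%:R) ler_powR // ler1n.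
set N := Num.truncn (D * n%:R `^ b).
have [f fP] := code_tuple (@short_word K) N.
have gcode g : growth_ball S n g -> exists t, g = f t.
  move=> /growth_ball_second_level [pi [rho [F [-> FP]]]]; apply: fP.
  have {FP} /choice [m mP] x : exists m : 'F_p -> nat, forall y,
      (m y)%:R <= 2 * (B + 1) `^ b * n%:R `^ b /\ code (@short_word K) (m y) (F x y).
    have /choice [m mP] y : exists m, m%:R <= 2 * (B + 1) `^ b * n%:R `^ b /\
        code (@short_word K) m (F x y).
      have [s sn ->] := FP x y; have [m mP mc] := codeP 1 s; exists m; split=> //.
      apply: (le_trans mP); rewrite -mulrA -powRM ?addr_ge0 //.
      rewrite lerBlDr (@le_trans _ _ (2 * ((B + 1) * n%:R) `^ b)) ?lerDl //.
      rewrite ler_pM2l //; apply: ge0_ler_powR => //.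
      - by rewrite nnegrE addr_ge0 // mulrn_wge0.
      - by rewrite nnegrE mulr_ge0 ?addr_ge0.
      rewrite mulrDl mul1r; apply: lerD; last by rewrite ler1n.
      by rewrite -[B *+ _]mulr_natr ler_wpM2l // ler_nat.
    by exists m.
  apply: (@code_le _ _ _ (\sum_x (\sum_y m x y).+1).+1); last first.
    by apply: code_wreath => x; apply: code_wreath => y; case: (mP x y).
  have mle x : (\sum_y m x y)%:R <= p%:R * (2 * (B + 1) `^ b * n%:R `^ b).
    rewrite natr_sum (le_trans (ler_sum _ (fun y _ => (mP x y).1))) //.
    by rewrite sumr_const card_Fp // -[leLHS]mulr_natl.
  rewrite /N truncn_ge_nat ?mulr_ge0 ?powR_ge0 //.
  have sle : (\sum_x (\sum_y m x y).+1)%:R <=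
      p%:R * (p%:R * (2 * (B + 1) `^ b * n%:R `^ b) + 1).
    rewrite natr_sum.
    apply: (@le_trans _ _ (\sum_(x : 'F_p) (p%:R * (2 * (B + 1) `^ b * n%:R `^ b) + 1))).
      by apply: ler_sum => x _; rewrite -natr1 lerD2r; exact: mle.
    by rewrite sumr_const card_Fp // -[leLHS]mulr_natl.
  rewrite -natr1; apply: (le_trans (lerD sle (lexx 1))).
  have : p%:R * 1 <= p%:R * n%:R `^ b by rewrite ler_wpM2l.
  rewrite /D; move: (n%:R `^ b) ((B + 1) `^ b) (p%:R : R) n1 => u v q u1 qu.
  rewrite -subr_ge0 (_ : _ - _ = (u - 1) + (q * u - q * 1)); last by ring.
  by rewrite addr_ge0 // subr_ge0.
have := growth_leq_card S_fin gcode; rewrite card_tuple => gN.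
apply: (@le_trans _ _ (#|{: A}| ^ N)%:R); first by rewrite ler_nat.
have A0 : 0 < #|{: A}|%:R :> R by apply: lt_le_trans A1.
rewrite natrX -[X in X ^+ _]lnK ?posrE // -expRM_natl ler_expR -mulrA mulrC.
by rewrite ler_wpM2l ?ln_ge0 // truncn_le mulr_ge0 ?powR_ge0.
Qed.

End UpperBound.

(** * Growth functions between stretched exponentials *)

Section GrowthAnalysis.
Variable R : realType.

(** Squaring e^(1/2) <= 2, which follows from e^(-1/2) >= 1/2. It lets the base 4 of the lower count
    replace e. *)
Lemma expR1_le4 : expR 1 <= 4 :> R.
Proof.
have := expR_ge1Dx (- 2^-1 : R); rewrite expRN => h.
have e0 := expR_gt0 (2^-1 : R).
have e2 : expR (2^-1 : R) <= 2.
  have : (2^-1 : R) <= (expR 2^-1)^-1 by apply: le_trans h; lra.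
  by rewrite lef_pV2 ?posrE.
have -> : (1 : R) = 2^-1 + 2^-1 by lra.
by rewrite expRD; nra.
Qed.

Lemma expR_ge_pow (x : R) j : 0 <= x -> (0 < j)%N -> (x / j%:R) ^+ j <= expR x.
Proof.
move=> x0 j0; have jR : 0 < j%:R :> R by rewrite ltr0n.
have y0 : 0 <= x / j%:R by rewrite divr_ge0 // ltW.
rewrite -{2}[x](divfK (lt0r_neq0 jR)) expRM_natr lerXn2r ?nnegrE ?expR_ge0 //.
by apply: le_trans (expR_ge1Dx _); rewrite lerDr.
Qed.

Lemma horner_norm_le (P : {poly R}) (x : R) : 1 <= x ->
  `|P.[x]| <= (\sum_(i < size P) `|P`_i|) * x ^+ size P.
Proof.
move=> x1; rewrite horner_coef mulr_suml (le_trans (ler_norm_sum _ _ _)) //.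
apply: ler_sum => i _; rewrite normrM ler_wpM2l // normrX ger0_norm ?(le_trans ler01) //.
by rewrite ler_weXn2l // ltnW.
Qed.

Lemma stretched_exp_ge_pow (gamma : nat -> R) (alpha : R) d : 0 < alpha ->
  {homo gamma : n m / (n <= m)%N >-> n <= m} ->
  growth_le (fun n => expR (n%:R `^ alpha)) gamma ->
  exists2 K, 0 < K & \forall n \near \oo, n%:R ^+ d <= K * gamma n.
Proof.
move=> a0 gh [C [C0 CP]].
have CR : 0 < C%:R :> R by rewrite ltr0n.
(* Chosen with [alpha j >= d], so that the j-th power of m^alpha dominates m^d. *)
pose j := (Num.bound (d%:R / alpha)).+1.
have jd : d%:R <= alpha * j%:R.
  rewrite mulrC -ler_pdivrMr // -natr1 ltW //.
  by rewrite (lt_le_trans (archi_boundP _)) ?divr_ge0 ?(ltW a0) // lerDl.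
have jR : 0 < j%:R :> R by rewrite ltr0n.
exists ((2 * C%:R) ^+ d * j%:R ^+ j); first by rewrite mulr_gt0 ?exprn_gt0 ?mulr_gt0.
near=> n.
have Cn : (C <= n)%N by near: n; exact: nbhs_infty_ge.
set m := (n %/ C)%N.
have m0 : (0 < m)%N by rewrite divn_gt0.
have m1 : 1 <= m%:R :> R by rewrite ler1n.
have nm : n%:R <= 2 * C%:R * m%:R :> R.
  rewrite -!natrM ler_nat {1}(divn_eq n C) -/m.
  rewrite -mulnA mul2n -addnn mulnC leq_add2l ltnW //.
  by apply: (leq_trans (ltn_pmod n C0)); rewrite leq_pmulr.
have mg : expR (m%:R `^ alpha) <= gamma n.
  by apply: (le_trans (CP m m0)); apply: gh; rewrite mulnC leq_trunc_div.
have me : m%:R ^+ d <= j%:R ^+ j * expR (m%:R `^ alpha).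
  have := expR_ge_pow (powR_ge0 (m%:R : R) alpha) (ltn0Sn _ : (0 < j)%N).
  rewrite expr_div_n ler_pdivrMr ?exprn_gt0 // mulrC; apply: le_trans.
  rewrite -[leRHS]powR_mulrn ?powR_ge0 // -powRrM -powR_mulrn ?(le_trans ler01) //.
  by rewrite ler_powR.
apply: (@le_trans _ _ ((2 * C%:R * m%:R) ^+ d)).
  by rewrite lerXn2r ?nnegrE ?mulr_ge0.
rewrite exprMn -mulrA ler_wpM2l ?exprn_ge0 ?mulr_ge0 //.
by apply: (le_trans me); rewrite ler_wpM2l ?exprn_ge0.
Unshelve. all: by end_near. Qed.

Lemma growth_bounds_intermediate (gamma : nat -> R) (alpha b : R) :
  0 < alpha -> 0 < b < 1 -> (forall n, 0 < gamma n) ->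
  {homo gamma : n m / (n <= m)%N >-> n <= m} ->
  growth_le (fun n => expR (n%:R `^ alpha)) gamma ->
  growth_le gamma (fun n => expR (n%:R `^ b)) -> intermediate_growth gamma.
Proof.
move=> a0 b01 g0 gh lower [C [C0 CP]].
have CR : 0 < C%:R :> R by rewrite ltr0n.
split=> [P|c c1]; apply/cvgr0Pnorm_le => e e0.
  (* One power more than needed to dominate [P], so the quotient is O(1/n). *)
  have [K K0 KP] := stretched_exp_ge_pow (size P).+1 a0 gh lower.
  pose L := \sum_(i < size P) `|P`_i|.
  have L0 : 0 <= L by rewrite sumr_ge0.
  near=> n.
  have n1 : (1 <= n)%N by near: n; exact: nbhs_infty_ge.
  have nR : 1 <= n%:R :> R by rewrite ler1n.
  have nP : 0 < n%:R :> R by rewrite ltr0n.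
  rewrite normf_div (gtr0_norm (g0 n)) ler_pdivrMr //.
  apply: (le_trans (horner_norm_le P nR)); rewrite -/L.
  have nL : L * K / e <= n%:R by near: n; exact: nbhs_infty_ger.
  have nK : n%:R ^+ (size P).+1 <= K * gamma n by near: n.
  rewrite -(ler_pM2l nP) mulrCA -exprS (le_trans (ler_wpM2l L0 nK)) //.
  rewrite mulrA mulrA ler_pM2r //; move: nL.
  by rewrite ler_pdivrMr.
have lc : 0 < ln c by rewrite ln_gt0.
(* This constant makes (C n)^b at most n ln c / 2, so gamma is eventually below the square root of
   c^n. *)
have [||M M0 MP] := @powR_sublinear R b (ln c / 2 / C%:R); rewrite ?divr_gt0 //.
near=> n.
have n1 : (1 <= n)%N by near: n; exact: nbhs_infty_ge.
have nM : M <= n%:R by near: n; exact: nbhs_infty_ger.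
have ne : e^-1 / (ln c / 2) <= n%:R by near: n; exact: nbhs_infty_ger.
have cn : 0 < c ^+ n by rewrite exprn_gt0 // (lt_trans ltr01).
rewrite normf_div (gtr0_norm (g0 n)) (gtr0_norm cn) ler_pdivrMr //.
apply: (le_trans (CP n n1)).
have MC : M <= (C * n)%:R.
  by apply: (le_trans nM); rewrite ler_nat leq_pmull.
apply: (@le_trans _ _ (expR (n%:R * (ln c / 2)))).
  rewrite ler_expR (le_trans (MP _ MC)) // natrM.
  by rewrite [X in _ <= X]mulrC [leLHS]mulrA divfK ?gt_eqF.
have -> : c ^+ n = expR (n%:R * (ln c / 2)) * expR (n%:R * (ln c / 2)).
  rewrite -expRD -mulrDr -splitr expRM_natl lnK // posrE.
  exact: lt_trans c1.
rewrite [leRHS]mulrA ler_peMl ?expR_ge0 //.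
rewrite -ler_pdivrMl // mulr1.
apply: (le_trans _ (expR_ge1Dx _)).
rewrite ler_pdivrMr ?divr_gt0 // in ne.
by apply: (le_trans ne); rewrite lerDr.
Unshelve. all: by end_near. Qed.

(** The polynomial is -2 at 0 and 1 at 1, and strictly increasing on positive arguments. *)
Lemma growth_eta_unique r : (2 < r)%N -> exists2 eta : R,
  unique (fun x : R => 0 < x /\ root (eta_poly R r) x) eta &
  [/\ 0 < eta, eta < 1 & eta ^+ r + eta ^+ (r - 1) + eta ^+ (r - 2) = 2].
Proof.
move=> r2.
have r0 : (0 < r)%N by exact: ltnW (ltnW r2).
have r1 : (0 < r - 1)%N by rewrite subn_gt0 ltnW.
have r3 : (0 < r - 2)%N by rewrite subn_gt0.
have hE (x : R) : (eta_poly R r).[x] = x ^+ r + x ^+ (r - 1) + x ^+ (r - 2) - 2.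
  by rewrite /eta_poly !hornerE.
have h0 : (eta_poly R r).[0] = -2 by rewrite hE !expr0n !gtn_eqF // !add0r.
have h1 : (eta_poly R r).[1] = 1 by rewrite hE !expr1n; ring.
have sgn : (eta_poly R r).[0] <= 0 <= (eta_poly R r).[1].
  by rewrite h0 h1 oppr_le0 ler0n ler01.
have [eta /andP [eta0 eta1] eta_root] := poly_ivt ler01 sgn.
have mono (x y : R) : 0 < x -> x < y ->
    (eta_poly R r).[x] < (eta_poly R r).[y].
  move=> x0 xy; have y0 := lt_trans x0 xy.
  by rewrite !hE ltrD2r !ltrD // ltrXn2r ?nnegrE ?ltW // -lt0n.
have e0 : 0 < eta.
  rewrite lt_neqAle eta0 andbT; apply: contraL eta_root => /eqP <-.
  by rewrite /root h0 oppr_eq0 pnatr_eq0.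
exists eta; [split=> [//|y [y0 yr]]|split=> //].
- move: eta_root yr; rewrite /root => /eqP E1 /eqP E2.
  by case: (ltgtP eta y) => // [/(mono _ _ e0)|/(mono _ _ y0)]; rewrite E1 E2 ltxx.
- rewrite lt_neqAle eta1 andbT; apply: contraL eta_root => /eqP ->.
  by rewrite /root h1 oner_eq0.
- by move: eta_root; rewrite /root hE subr_eq0 => /eqP.
Qed.

(** Lets estimates at powers of [q] cover all radii at the cost of a factor [q]. *)
Lemma pow_bracket q n : (1 < q)%N -> (0 < n)%N ->
  exists m, (n <= q ^ m <= q * n)%N.
Proof.
move=> q1 n0; case: n n0 => [//|[|n]] _.
  by exists 0%N; rewrite muln1 expn0 /= ltnW.
exists (up_log q n.+2); rewrite up_logP //=.
have := up_log_gtn q1 (isT : (1 < n.+2)%N); have := up_log_gt0 q n.+2.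
rewrite q1 /=; case: (up_log q n.+2) => // k _ /ltnW kn.
by rewrite expnS leq_mul2l kn orbT.
Qed.

Lemma growth_lower_bound p (lam : 'Z_(p ^ 2) -> 'F_p * 'F_p) :
  prime p -> (2 < p)%N ->
  growth_le (fun n => expR (n%:R `^ (ln p%:R / (ln p%:R + ln 2%:R))))
    (fun n => (growth [set sush_A p; sush_B lam] n)%:R : R).
Proof.
move=> p_prime p_gt2; set S := [set sush_A p; sush_B lam].
have S_fin : finite_set S by rewrite finite_setU; split; exact: finite_set1.
have p0 := prime_gt0 p_prime; have p1 := prime_gt1 p_prime.
have [k k0 kP] := large_pairs_set lam p_prime p_gt2.
have [C CP] := large_pairs_growth lam p_prime.
exists ((C.+1 * k) * (2 * p))%N; split=> [|n n0]; first by rewrite !muln_gt0 k0 p0.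
have q1 : (1 < 2 * p)%N by rewrite (@leq_mul 2 1).
have [m /andP [nm mn]] := pow_bracket q1 n0.
have pR : 0 < p%:R :> R by rewrite ltr0n.
have lp : 0 < ln p%:R :> R by rewrite ln_gt0 // ltr1n.
have l2 : 0 < ln 2 :> R by rewrite ln_gt0 // ltr1n.
set alpha := _ / _.
have a0 : 0 <= alpha by rewrite divr_ge0 // ltW // addr_gt0.
(* The exponent [alpha] is defined by (2p)^alpha = p. *)
have E : ((2 * p) ^ m)%:R `^ alpha = (p ^ m)%:R :> R.
  rewrite !natrX natrM -powR_mulrn ?mulr_ge0 // -powRrM [m%:R * alpha]mulrC powRrM.
  rewrite -powR_mulrn ?ler0n //; congr (_ `^ _).
  rewrite /powR gt_eqF ?mulr_gt0 // lnM ?posrE // [ln 2 + _]addrC divfK ?gt_eqF ?addr_gt0 //.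
  by rewrite lnK.
apply: (@le_trans _ _ (4 ^ (p ^ m))%:R).
  apply: (@le_trans _ _ (expR ((p ^ m)%:R))).
    by rewrite ler_expR -E ge0_ler_powR ?nnegrE // ler_nat.
  rewrite -[(p ^ m)%:R]mulr1 expRM_natl natrX lerXn2r ?nnegrE ?expR_ge0 //.
  exact: expR1_le4.
rewrite ler_nat; apply: (leq_trans (CP _ _ (kP m 1))); apply: growth_homo => //.
by rewrite -!mulnA leq_mul // leq_mul2l mulnA mn orbT.
Qed.

End GrowthAnalysis.

(** * Combination of the two bounds for an arbitrary finite generating set *)

Theorem theorem16 (R : realType) (p : nat) (p_prime : prime p)
    (p_gt2 : (2 < p)%N) (lam : 'Z_(p ^ 2) -> 'F_p * 'F_p)
    (lam_bij : bijective lam) (S : set (tree_aut 'F_p))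
    (S_fin : finite_set S) (S_gen : gen_subgroup S = sushchansky_group lam) :
  let gamma := fun n : nat => (growth S n)%:R : R in
  intermediate_growth gamma /\
  exists eta : R,
    unique (fun x : R => 0 < x /\ root (eta_poly R (p ^ 2)) x) eta /\
    let alpha := ln p%:R / (ln p%:R + ln 2%:R) : R in
    let beta := ln p%:R / (ln p%:R - ln eta) : R in
    growth_le (fun n => expR (n%:R `^ alpha)) gamma /\
    growth_le gamma (fun n => expR (n%:R `^ beta)).
Proof.
move=> gamma.
have [eta eta_unique [eta0 eta1 eta_root]] := growth_eta_unique R (sqr_gt2 p_prime p_gt2).
have pR : 0 < p%:R :> R by rewrite ltr0n prime_gt0.
have lp : 0 < ln p%:R :> R by rewrite ln_gt0 // ltr1n prime_gt1.
have l2 : 0 < ln 2 :> R by rewrite ln_gt0 // ltr1n.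
have le : ln eta < 0 by rewrite ln_lt0 // eta0.
pose alpha : R := ln p%:R / (ln p%:R + ln 2%:R).
pose b : R := ln p%:R / (ln p%:R - ln eta).
have a0 : 0 < alpha by rewrite divr_gt0 // addr_gt0.
have d0 : 0 < ln p%:R - ln eta by rewrite subr_gt0 (lt_trans le).
have b01 : 0 < b < 1.
  by rewrite divr_gt0 //= ltr_pdivrMr // mul1r ltrDl oppr_gt0.
have b_eta : p%:R * (eta / p%:R) `^ b = 1.
  rewrite /powR gt_eqF ?divr_gt0 // lnM ?posrE ?invr_gt0 // lnV ?posrE //.
  have -> : b * (ln eta + - ln p%:R) = - ln p%:R.
    by rewrite /b; field; rewrite gt_eqF.
  by rewrite expRN lnK ?posrE // mulfV // gt_eqF.
set S0 : set (tree_aut 'F_p) := [set sush_A p; sush_B lam].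
have S0_fin : finite_set S0 by rewrite finite_setU; split; exact: finite_set1.
have subgen (T : set (tree_aut 'F_p)) : T `<=` gen_subgroup T.
  by move=> g Tg H [_]; apply.
have [L1 L1_gt0 SS0] : exists2 L, (0 < L)%N &
    forall n, growth_ball S n `<=` growth_ball S0 (L * n).
  apply: growth_ball_sub => //.
  by rewrite -[gen_subgroup S0]/(sushchansky_group lam) -S_gen; exact: subgen.
have [L2 L2_gt0 S0S] : exists2 L, (0 < L)%N &
    forall n, growth_ball S0 n `<=` growth_ball S (L * n).
  apply: growth_ball_sub => //.
  by rewrite S_gen; exact: (subgen S0).
have lower : growth_le (fun n => expR (n%:R `^ alpha)) gamma.
  have [C [C0 CP]] := growth_lower_bound R lam p_prime p_gt2.
  exists (L2 * C)%N; split=> [|n n0]; first by rewrite muln_gt0 L2_gt0.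
  apply: (le_trans (CP n n0)); rewrite ler_nat -mulnA.
  exact: leq_growth.
have upper : growth_le gamma (fun n => expR (n%:R `^ b)).
  have [C C0 CP] := growth_upper_bound p_prime p_gt2 lam_bij eta0 eta1 eta_root b01 b_eta.
  have [b0 b1] := andP b01.
  (* A dilation of the radius absorbs the constant in the exponent: C n^b <= (D n)^b. *)
  pose D := (Num.bound (C `^ b^-1)).+1.
  have CD : C <= D%:R `^ b.
    rewrite -[leLHS](powRr1 C0) -[X in _ `^ X](mulVf (lt0r_neq0 b0)) powRrM.
    apply: ge0_ler_powR; rewrite ?nnegrE ?powR_ge0 ?(ltW b0) //.
    by rewrite -natr1 ltW // (lt_le_trans (archi_boundP (powR_ge0 _ _))) // lerDl.
  exists (D * L1)%N; split=> [|n n0]; first by rewrite muln_gt0.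
  apply: (@le_trans _ _ (growth S0 (L1 * n))%:R).
    by rewrite ler_nat; apply: leq_growth.
  apply: (le_trans (CP _ _)); first by rewrite muln_gt0 L1_gt0.
  by rewrite ler_expR -mulnA [(D * _)%:R]natrM powRM // ler_wpM2r ?powR_ge0.
split; last by exists eta.
apply: (growth_bounds_intermediate a0 b01) => //.
  move=> n; rewrite ltr0n cardfs_gt0; apply/fset0Pn; exists 1%g.
  by rewrite in_fset_set ?inE; [exact: growth_ball1|exact: finite_growth_ball].
by move=> n m nm; rewrite ler_nat; exact: growth_homo.
Qed.
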